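(* TAP restricted to instances that are simultaneously $2$-occurrence and $2$-weight is solvable exactly in polynomial time.
   Context: Target Approximation Problem (TAP): the input is a groundset $U=\{1,\dots,n\}$ of features, a target $T\subseteq U$, and a collection $S=\{E_1,\dots,E_m\}$ of exemplars, each $E_j\subseteq U$. Features in $U\cap T$ are blue, features in $U\setminus T$ are red. A feature appears in $S'\subseteq S$ if it lies in $\bigcup_{E\in S'}E$. The margin of $S'$ is (number of blue features appearing in $S'$) minus (number of red features appearing in $S'$); TAP asks for $S'$ of maximum margin. It is assumed that every feature appears in at least one exemplar and that $T$ and all exemplars are nonempty. An instance is $k$-occurrence if every feature belongs to at most $k$ exemplars, and $w$-weight if every exemplar contains at most $w$ features. *)

(* Defs.v *)
From mathcomp Require Import all_boot all_order all_algebra.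
Set Implicit Arguments. Unset Strict Implicit. Unset Printing Implicit Defensive.
Import GRing.Theory Num.Theory.

(* Target Approximation Problem (TAP).                                  *)
(* Features are 'I_n (i.e. {0,..,n-1} instead of {1,..,n}), exemplars   *)
(* are indexed by 'I_m, exemplar j is the set S j, the target is T.     *)

Definition appearing (n m : nat) (S : 'I_m -> {set 'I_n}) (S' : {set 'I_m})
  : {set 'I_n} := \bigcup_(j in S') S j.

Definition margin (n m : nat) (T : {set 'I_n}) (S : 'I_m -> {set 'I_n})
  (S' : {set 'I_m}) : int :=
  (#|appearing S S' :&: T|%:Z - #|appearing S S' :\: T|%:Z)%R.

Definition optimal (n m : nat) (T : {set 'I_n}) (S : 'I_m -> {set 'I_n})
  (S' : {set 'I_m}) : Prop :=
  forall S'' : {set 'I_m}, (margin T S S'' <= margin T S S')%R.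

Definition valid_instance (n m : nat) (T : {set 'I_n}) (S : 'I_m -> {set 'I_n})
  : Prop :=
  [/\ forall i : 'I_n, exists j : 'I_m, i \in S j,
      T != set0 &
      forall j : 'I_m, S j != set0].

Definition k_occurrence (k n m : nat) (S : 'I_m -> {set 'I_n}) : Prop :=
  forall i : 'I_n, #|[set j : 'I_m | i \in S j]| <= k.

Definition w_weight (w n m : nat) (S : 'I_m -> {set 'I_n}) : Prop :=
  forall j : 'I_m, #|S j| <= w.

(* Model of computation: unit-cost RAM with addition, truncated         *)
(* subtraction, constants, indirect addressing and conditional jumps    *)
(* (polynomially equivalent to Turing machines, Cook-Reckhow).          *)

Inductive instr : Type :=
| IConst of nat & nat          (* IConst r v   : M[r] := v              *)
| IAdd of nat & nat & nat      (* IAdd r a b   : M[r] := M[a] + M[b]    *)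
| ISub of nat & nat & nat      (* ISub r a b   : M[r] := M[a] - M[b]    *)
| ILoad of nat & nat           (* ILoad r a    : M[r] := M[M[a]]        *)
| IStore of nat & nat          (* IStore a r   : M[M[a]] := M[r]        *)
| IJz of nat & nat             (* IJz r l      : if M[r] = 0 goto l     *)
| IJmp of nat.                 (* IJmp l       : goto l                 *)

Definition memory := nat -> nat.

Definition upd (M : memory) (r v : nat) : memory :=
  fun x => if x == r then v else M x.

Definition step (p : seq instr) (pc : nat) (M : memory) : nat * memory :=
  match nth (IJmp 0) p pc with
  | IConst r v => (pc.+1, upd M r v)
  | IAdd r a b => (pc.+1, upd M r (M a + M b))
  | ISub r a b => (pc.+1, upd M r (M a - M b))
  | ILoad r a => (pc.+1, upd M r (M (M a)))
  | IStore a r => (pc.+1, upd M (M a) (M r))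
  | IJz r l => (if M r == 0 then l else pc.+1, M)
  | IJmp l => (l, M)
  end.

Fixpoint run (fuel : nat) (p : seq instr) (pc : nat) (M : memory)
  : option memory :=
  if size p <= pc then Some M else
  match fuel with
  | 0 => None
  | f.+1 => let: (pc', M') := step p pc M in run f p pc' M'
  end.

(* Input encoding of an instance: M[0] = n, M[1] = m,
   M[2+i] = [i \in T] for i < n,
   M[2+n+j*n+i] = [i \in S j] for j < m, i < n, all other cells 0. *)
Definition encode (n m : nat) (T : {set 'I_n}) (S : 'I_m -> {set 'I_n})
  : memory :=
  fun x =>
    if x == 0 then n else
    if x == 1 then m else
    if x < 2 + n then
      (if insub (x - 2) is Some i then nat_of_bool (i \in T) else 0) else
    if x < 2 + n + m * n then
      (let y := x - (2 + n) in
       match insub (y %/ n), insub (y %% n) with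
       | Some j, Some i => nat_of_bool (i \in S j)
       | _, _ => 0
       end)
    else 0.

Definition decode (m : nat) (M : memory) : {set 'I_m} :=
  [set j : 'I_m | M (nat_of_ord j) != 0].

(* Main.v *)
Require Import Defs.
From mathcomp Require Import all_boot all_order all_algebra.
From mathcomp Require Import zify.
Set Implicit Arguments. Unset Strict Implicit. Unset Printing Implicit Defensive.

(** A mixed exemplar [{b, r}] pays for its red feature [r] only together with the
    other exemplar containing [r]: exemplars without red are always taken,
    exemplars without blue never, and two mixed exemplars sharing their red
    feature gain exactly 1 when their blue features are distinct and otherwise
    uncovered.  So the blue features are the vertices and the shared red features
    the edges of a graph, in which one looks for a maximum matching.  Occurrence at
    most 2 makes its maximum degree at most 2.  Matching edges greedily, an edge
    with an end of degree one whenever there is one and an arbitrary edge when only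
    cycles remain, is optimal: rotating a matching along a cycle until it contains
    the chosen edge does not change its size.

    The RAM program is compiled from a language with counting loops and unbounded
    arrays, which are interleaved in memory.  Since the input occupies all the low
    cells, the program first copies it above an address that exceeds the input
    length, and at the end it moves the answer back down. *)

(** * Matchings in graphs of maximum degree two *)

(* The elements are darts, an edge being a pair [{j, p j}] and a vertex a pair
   [{j, q j}]; [p] and [q] may leave the set of darts under consideration, at a
   missing edge end or at a vertex of degree one. *)
Section Matchings.
Variables (E : finType) (p q : E -> E).
Implicit Types (X Y Z : {set E}) (c j k : E).

Definition partial_involution (f : E -> E) X : Prop :=
  {in X, forall j, f j != j /\ (f j \in X -> f (f j) = j)}.

Lemma partial_involutionS f X X' :
  X' \subset X -> partial_involution f X -> partial_involution f X'.
Proof. by move=> /subsetP s h j /s/h[? fK]; split=> // /s. Qed.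

Definition matching X Y : Prop :=
  forall j, j \in Y -> [/\ j \in X, p j \in Y & q j \notin Y].

Definition maximum_matching X Y : Prop :=
  matching X Y /\ forall Z, matching X Z -> #|Z| <= #|Y|.

Definition matchable X j : bool := [&& j \in X, p j \in X & p j != q j].

Lemma matching_subset X Y : matching X Y -> Y \subset X.
Proof. by move=> mY; apply/subsetP=> j /mY[]. Qed.

Lemma matching_within X X' Y : Y \subset X' -> matching X Y -> matching X' Y.
Proof. by move=> /subsetP s mY j jY; have [_ ? ?] := mY _ jY; split=> //; apply: s. Qed.

Lemma matching_matchable X Y j : matching X Y -> j \in Y -> matchable X j.
Proof.
move=> mY jY; have [jX pY qY] := mY _ jY; have [pX _ _] := mY _ pY.
by rewrite /matchable jX pX; apply: contraNneq qY => <-.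
Qed.

Lemma matching_partner X Y j : partial_involution p X -> matching X Y ->
  j \in X -> p j \in X -> (p j \in Y) = (j \in Y).
Proof.
move=> p_inv mY jX pX; apply/idP/idP => [/mY[_ + _]|/mY[]//].
by have [_ ->] := p_inv _ jX.
Qed.

Lemma matching_setD_edge X Y j : partial_involution p X -> matching X Y ->
  j \in X -> p j \in X -> matching X (Y :\: [set j; p j]).
Proof.
move=> p_inv mY jX pX k; rewrite !inE negb_or => /andP[/andP[kj kp] kY].
have [kX pY qY] := mY _ kY; split=> //; last by rewrite (negPf qY) andbF.
have [_ pk] := p_inv _ kX; have [_ /(_ pX) pj] := p_inv _ jX.
rewrite pY andbT; apply/norP; split; apply/eqP=> e.
  by move/eqP: kp; apply; rewrite -e pk // e.
by move/eqP: kj; apply; rewrite -pk e // pj.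
Qed.

Lemma leq_card_setD2 Y j k : #|Y| <= #|Y :\: [set j; k]| + 2.
Proof.
rewrite cardsD -leq_subLR subKn ?subset_leq_card ?subsetIl //.
by rewrite (leq_trans (subset_leq_card (subsetIr _ _))) // cards2; case: eqP.
Qed.

Definition remaining X c : {set E} := X :\: [set c; p c; q c; q (p c)].

Lemma in_remaining X c k : (k \in remaining X c) =
  [&& k != c, k != p c, k != q c, k != q (p c) & k \in X].
Proof. by rewrite !inE !negb_or -!andbA. Qed.

Lemma remaining_sub X c : remaining X c \subset X.
Proof. exact: subsetDl. Qed.

(* Cardinals count darts: an edge costs 2. *)
Definition safe X c : Prop := forall Y, matching X Y ->
  exists2 Y', matching (remaining X c) Y' & #|Y| <= #|Y'| + 2.

Lemma matching_remaining X Y c : matching X Y ->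
  c \notin Y -> p c \notin Y -> q c \notin Y -> q (p c) \notin Y ->
  matching (remaining X c) Y.
Proof.
move=> mY cY pY qY qpY; apply: (matching_within _ mY).
apply/subsetP=> k kY; have [kX _ _] := mY _ kY.
by rewrite in_remaining kX andbT; apply/and4P; split; apply: contraTneq kY => ->.
Qed.

Lemma matching_remaining_edge X Y c : partial_involution p X -> matching X Y ->
  c \in Y -> matching (remaining X c) (Y :\: [set c; p c]).
Proof.
move=> p_inv mY cY; have [cX pY qY] := mY _ cY; have [pX _ qpY] := mY _ pY.
apply: matching_remaining; first exact: matching_setD_edge.
all: by rewrite !inE ?eqxx ?orbT ?(negPf qY) ?(negPf qpY) ?andbF.
Qed.

Lemma leaf_safe X c : partial_involution p X -> matchable X c ->
  ~~ matchable X (q c) -> safe X c.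
Proof.
move=> p_inv /and3P[cX pX pq] leaf Y mY.
have qY : q c \notin Y by apply: contra leaf; exact: matching_matchable.
have [cY|cY] := boolP (c \in Y).
  exists (Y :\: [set c; p c]); [exact: matching_remaining_edge|exact: leq_card_setD2].
have pY : p c \notin Y by rewrite (matching_partner p_inv mY).
have [qpY|qpY] := boolP (q (p c) \in Y); last first.
  by exists Y; [exact: matching_remaining|exact: leq_addr].
exists (Y :\: [set q (p c); p (q (p c))]); last exact: leq_card_setD2.
have [qpX /mY[pqpX _ _] _] := mY _ qpY.
apply: matching_remaining; first exact: matching_setD_edge.
all: by rewrite !inE ?eqxx ?(negPf cY) ?(negPf pY) ?(negPf qY) ?andbF.
Qed.

(** * Rotating a matching along a cycle *)

Section Cycles.
Variable X : {set E}.
Hypotheses (p_in : {in X, forall j, p j \in X}) (q_in : {in X, forall j, q j \in X}).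
Hypotheses (pK : {in X, forall j, p (p j) = j}) (qK : {in X, forall j, q (q j) = j}).
Hypotheses (p_neq : {in X, forall j, p j != j}) (q_neq : {in X, forall j, q j != j}).

Definition advance j : E := if j \in X then q (p j) else j.

Lemma advanceE : {in X, forall j, advance j = q (p j)}.
Proof. by move=> j jX; rewrite /advance jX. Qed.

Lemma advance_inj : injective advance.
Proof.
apply: (can_inj (g := fun j => if j \in X then p (q j) else j)) => j.
rewrite /advance; have [jX|/negPf->//] := boolP (j \in X).
by rewrite q_in ?qK ?pK ?p_in.
Qed.

Lemma iter_advance_neq_p t j : j \in X -> iter t advance j != p j.
Proof.
have [N] := ubnP t; elim: N t j => // N IH [|[|t]] j tN jX.
- by rewrite eq_sym p_neq.
- by rewrite /= advanceE // q_neq ?p_in.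
rewrite iterS iterSr (advanceE jX); set j' := q (p j).
have j'X : j' \in X by rewrite q_in ?p_in.
have -> : p j = advance (p j') by rewrite advanceE ?p_in // pK // qK ?p_in.
by rewrite (inj_eq advance_inj) IH // -ltnS ltnW.
Qed.

Definition on_orbit c j : bool := fconnect advance c j.

Lemma on_orbit_advance c j : j \in X -> on_orbit c (q (p j)) = on_orbit c j.
Proof.
by move=> jX; rewrite -advanceE // /on_orbit -(same_fconnect1_r advance_inj).
Qed.

Lemma on_orbit_partner c j : j \in X -> on_orbit c j -> ~~ on_orbit c (p j).
Proof.
move=> jX; rewrite /on_orbit (fconnect_sym advance_inj) => jc; apply/negP=> cp.
have /iter_findex e := connect_trans jc cp.
by have := iter_advance_neq_p (findex advance j (p j)) jX; rewrite e eqxx.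
Qed.

(* The darts on the orbit of [c] and their partners run along the same cycle
   in opposite directions, so that [rotate] is an automorphism. *)
Definition rotate c j : E :=
  if on_orbit c j then q (p j) else if on_orbit c (p j) then p (q j) else j.

Lemma rotate_p c j : j \in X -> rotate c (p j) = p (rotate c j).
Proof.
move=> jX; rewrite /rotate pK //; have [cj|cj] := boolP (on_orbit c j).
  by rewrite (negPf (on_orbit_partner jX cj)).
by case: ifP => _ //; rewrite pK ?q_in.
Qed.

Lemma rotate_q c j : j \in X -> rotate c (q j) = q (rotate c j).
Proof.
move=> jX; have qX := q_in jX; have pX := p_in jX.
have qE : on_orbit c (q j) = on_orbit c (p j) by rewrite -{1}(pK jX) on_orbit_advance.
have pqE : on_orbit c (p (q j)) = on_orbit c j.
  by rewrite -(on_orbit_advance c (p_in qX)) pK // qK.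
rewrite /rotate qE pqE qK //; have [cj|cj] := boolP (on_orbit c j).
  by rewrite (negPf (on_orbit_partner jX cj)) qK.
by case: ifP.
Qed.

Lemma rotate_surj c j : j \in X -> exists2 k, k \in X & rotate c k = j.
Proof.
move=> jX; have qX := q_in jX; have pX := p_in jX.
have [cj|cj] := boolP (on_orbit c j).
  exists (p (q j)); first exact: p_in.
  by rewrite /rotate -(on_orbit_advance c (p_in qX)) pK // qK // cj.
have [cp|cp] := boolP (on_orbit c (p j)); last first.
  by exists j; rewrite // /rotate (negPf cj) (negPf cp).
exists (q (p j)); first exact: q_in.
rewrite /rotate on_orbit_advance // (negPf cj).
by rewrite -(on_orbit_advance c) ?p_in ?q_in // pK ?q_in // qK // cp pK.
Qed.

Lemma matching_rotate c Y t : c \in X -> matching X Y ->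
  exists Y', [/\ matching X Y', #|Y| <= #|Y'| & (c \in Y') = (iter t advance c \in Y)].
Proof.
move=> cX; elim: t Y => [|t IH] Y mY; first by exists Y.
pose Y1 := [set j in X | rotate c j \in Y].
have inY1 j : j \in X -> (j \in Y1) = (rotate c j \in Y) by rewrite inE => ->.
have mY1 : matching X Y1.
  move=> j; rewrite inE => /andP[jX /mY[_ pY qY]].
  by split=> //; rewrite inY1 ?p_in ?q_in // ?rotate_p ?rotate_q.
have cY1 : #|Y| <= #|Y1|.
  apply: leq_trans (leq_imset_card (rotate c) _); apply: subset_leq_card.
  apply/subsetP=> j jY; have jX := subsetP (matching_subset mY) _ jY.
  have [k kX e] := rotate_surj c jX.
  by apply/imsetP; exists k; rewrite // inY1 // e.
have [Y' [mY' cY' eY']] := IH _ mY1; exists Y'; split=> //; first exact: leq_trans cY1 _.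
have ikX : iter t advance c \in X.
  by elim: {+}t => //= t' tX; rewrite advanceE // q_in ?p_in.
by rewrite eY' inY1 // /rotate /on_orbit fconnect_iter iterS advanceE.
Qed.

Lemma cycle_safe_closed c : c \in X -> safe X c.
Proof.
move=> cX Y mY.
have p_inv : partial_involution p X by move=> j jX; split; rewrite ?p_neq ?pK.
have [/existsP[y /andP[yY /iter_findex e]]|none] :=
  boolP [exists y, (y \in Y) && on_orbit c y].
  have [Y' [mY' cY' eY']] := matching_rotate (findex advance c y) cX mY.
  rewrite e yY in eY'; exists (Y' :\: [set c; p c]).
    exact: matching_remaining_edge.
  exact: leq_trans cY' (leq_card_setD2 _ _ _).
have off y : on_orbit c y -> y \notin Y.
  by move=> cy; move/existsPn/(_ y): none; rewrite cy andbT.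
have cc : on_orbit c c by exact: connect0.
exists Y; last exact: leq_addr.
apply: matching_remaining => //; first exact: off.
- by rewrite (matching_partner p_inv mY) ?p_in // off.
- rewrite -(matching_partner p_inv mY) ?p_in ?q_in // off //.
  by rewrite -on_orbit_advance ?p_in ?q_in // pK ?qK ?q_in.
- by rewrite off // on_orbit_advance.
Qed.

End Cycles.

Lemma safeS X X' c : (forall Y, matching X Y -> Y \subset X') -> X' \subset X ->
  safe X' c -> safe X c.
Proof.
move=> sY sX sc Y mY; have mY2 := matching_within (sY _ mY) mY.
have [Y' mY' cY'] := sc Y mY2.
exists Y' => //; apply: (matching_within _ mY').
exact: subset_trans (matching_subset mY') (setSD _ sX).
Qed.

Lemma cycle_safe X c : partial_involution p X -> partial_involution q X ->
  matchable X c -> (forall j, matchable X j -> matchable X (q j)) -> safe X c.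
Proof.
move=> p_inv q_inv matchable_c mq; pose X' := [set j | matchable X j].
have inX j : matchable X j -> j \in X by case/and3P.
have qK j : matchable X j -> q (q j) = j.
  by move=> mj; have [_ ->//] := q_inv _ (inX _ mj); apply/inX/mq.
have mp j : matchable X j -> matchable X (p j).
  move=> mj; have /and3P[jX pX pq] := mj; have [_ ppj] := p_inv _ jX.
  rewrite /matchable pX ppj // jX /=; apply: contraNneq pq => e.
  by rewrite {2}e; have [_ ->] := q_inv _ pX; rewrite -?e.
apply: (@safeS X X').
- by move=> Y mY; apply/subsetP=> j jY; rewrite inE (matching_matchable mY).
- by apply/subsetP=> j; rewrite inE => /inX.
apply: cycle_safe_closed; rewrite ?inE // => j; rewrite !inE => mj.
- exact: mp.
- exact: mq.
- by have /and3P[jX pX _] := mj; have [_ ->] := p_inv _ jX.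
- exact: qK.
- by have [] := p_inv _ (inX _ mj).
- by have [] := q_inv _ (inX _ mj).
Qed.

(** * Greedy construction of a maximum matching *)

Definition partial_matching X0 X Y : Prop :=
  [/\ X \subset X0, matching X0 Y, [disjoint Y & X] & {in Y, forall j, q j \notin X}].

Definition optimally_extendable X0 X Y : Prop := forall Z, matching X0 Z ->
  exists2 Z', matching X Z' & #|Z| <= #|Y| + #|Z'|.

Section GreedyStep.
Variables X0 X Y : {set E}.
Hypotheses (p_inv : partial_involution p X0) (q_inv : partial_involution q X0).
Hypothesis partialY : partial_matching X0 X Y.
Variable c : E.
Hypothesis matchable_c : matchable X c.

Lemma partial_matching_add :
  partial_matching X0 (remaining X c) (Y :|: [set c; p c]).
Proof.
have [sX mY dYX qY] := partialY; have /and3P[cX pX pq] := matchable_c.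
have sX0 := subsetP sX; have [cp /(_ (sX0 _ pX)) ppc] := p_inv (sX0 _ cX).
have [[nqc _] [nqp qqp]] := (q_inv (sX0 _ cX), q_inv (sX0 _ pX)).
have q_off j : j \in X -> q j \notin Y.
  move=> jX; apply/negP=> qjY; have := qY _ qjY; have [qX _ _] := mY _ qjY.
  by have [_ ->//] := q_inv (sX0 _ jX); rewrite jX.
have qpc : q (p c) != c by apply: contraNneq pq => e; rewrite -{2}e qqp ?e ?sX0.
have new : [disjoint [set c; p c] & remaining X c].
  by rewrite disjoint_sym disjoints_subset; apply/subsetP=> j; rewrite in_remaining !inE;
    case/and3P=> /negPf-> /negPf->.
split.
- exact: subset_trans (remaining_sub _ _) sX.
- move=> j; rewrite !inE => /or3P[jY|/eqP->|/eqP->].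
  + have [jX0 pY qjY] := mY _ jY; rewrite pY (negPf qjY); split=> //=.
    by apply/norP; split; apply: contraNneq (qY _ jY) => ->.
  + by rewrite eqxx !orbT sX0 // (negPf (q_off _ cX)) (negPf nqc) eq_sym.
  + by rewrite ppc eqxx !orbT sX0 // (negPf (q_off _ pX)) (negPf nqp) (negPf qpc).
- rewrite -setI_eq0 setIUl setU_eq0 !setI_eq0 new andbT.
  exact: disjointWr (remaining_sub _ _) dYX.
- move=> j; rewrite in_remaining !inE => /or3P[/qY/negPf->|/eqP->|/eqP->].
  all: by rewrite ?eqxx ?andbF.
Qed.

Lemma optimally_extendable_add : safe X c -> optimally_extendable X0 X Y ->
  optimally_extendable X0 (remaining X c) (Y :|: [set c; p c]).
Proof.
move=> sc opt Z /opt[Z1 /sc[Z2 mZ2 cZ2] cZ]; exists Z2 => //.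
have [sX _ dYX _] := partialY; have /and3P[cX pX _] := matchable_c.
have [cp _] := p_inv (subsetP sX _ cX).
have dYc : [disjoint Y & [set c; p c]].
  by apply: disjointWr dYX; apply/subsetP=> j; rewrite !inE => /orP[]/eqP->.
move: dYc; rewrite -leq_card_setU => /eqP->; rewrite cards2 eq_sym cp.
by apply: leq_trans cZ _; rewrite -addnA leq_add2l addnC.
Qed.

End GreedyStep.

Lemma partial_matching0 X : partial_matching X X set0.
Proof. by split=> [//|j||j]; rewrite ?inE // disjoints_subset sub0set. Qed.

Lemma optimally_extendable0 X : optimally_extendable X X set0.
Proof. by move=> Z mZ; exists Z; rewrite // cards0. Qed.

Lemma greedy_maximum X0 X Y : partial_matching X0 X Y ->
  optimally_extendable X0 X Y -> (forall j, ~~ matchable X j) ->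
  maximum_matching X0 Y.
Proof.
move=> [_ mY _ _] opt none; split=> // Z /opt[Z' mZ' cZ]; apply: leq_trans cZ _.
suff -> : Z' = set0 by rewrite cards0 addn0.
by apply/setP=> j; rewrite inE; apply: contraNF (none j); exact: matching_matchable.
Qed.

End Matchings.

(** * Margins and matchings *)

Lemma card_le2_eq (E : finType) (A : {set E}) j k l : #|A| <= 2 ->
  j \in A -> k \in A -> l \in A -> k != j -> l != j -> k = l.
Proof.
move=> A2 jA kA lA kj lj; apply: contraTeq A2 => kl; rewrite -ltnNge.
have <- : #|[set j; k; l]| = 3.
  by rewrite -setUA cardsU1 cards2 !inE negb_or ![j == _]eq_sym kj lj kl.
by apply: subset_leq_card; rewrite !subUset !sub1set jA kA.
Qed.

Section Shades.
Variables (F : finType) (T : {set F}).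
Implicit Types (b : bool) (i : F) (X Y : {set F}).

(* The colour [true] is blue, [false] is red. *)
Definition shade b X : {set F} := if b then X :&: T else X :\: T.

Lemma in_shade b X i : (i \in shade b X) = (i \in X) && ((i \in T) == b).
Proof. by case: b; rewrite !inE; case: (i \in T); rewrite ?andbT ?andbF. Qed.

Lemma card_shades X : #|shade true X| + #|shade false X| = #|X|.
Proof. exact: cardsID. Qed.

Lemma shadeU b X Y : shade b (X :|: Y) = shade b X :|: shade b Y.
Proof. by case: b; rewrite /= (setIUl, setDUl). Qed.

Lemma shadeS b X Y : X \subset Y -> shade b X \subset shade b Y.
Proof. by case: b; [exact: setSI|exact: setSD]. Qed.

Definition meets b X Y : bool := shade b (X :&: Y) != set0.

Lemma meetsP b X Y :
  reflect (exists i, [/\ i \in X, i \in Y & (i \in T) == b]) (meets b X Y).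
Proof.
apply: (iffP (set0Pn _)) => -[i].
  by rewrite in_shade inE => /andP[/andP[? ?] ?]; exists i.
by case=> iX iY ib; exists i; rewrite in_shade inE iX iY.
Qed.

Lemma meetsC b X Y : meets b X Y = meets b Y X.
Proof. by rewrite /meets setIC. Qed.

End Shades.

Section Exemplars.
Variables (F E : finType) (T : {set F}) (S : E -> {set F}).
Implicit Types (b : bool) (i : F) (j k : E) (A Y Z : {set E}) (f : E -> E).

Definition covered A : {set F} := \bigcup_(j in A) S j.

Lemma coveredU A Y : covered (A :|: Y) = covered A :|: covered Y.
Proof. exact: bigcup_setU. Qed.

Lemma coveredS A Y : A \subset Y -> covered A \subset covered Y.
Proof. by move/setUidPr <-; rewrite coveredU subsetUl. Qed.

Definition pure : {set E} := [set j | ~~ meets T false (S j) (S j)].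

Definition live : {set E} :=
  [set j | [&& meets T true (S j) (S j), meets T false (S j) (S j) &
     [forall k in pure, ~~ meets T true (S j) (S k)]]].

Definition partner_map b f : Prop :=
  {in live, forall j, f j != j /\
     {in live, forall k, k != j -> meets T b (S j) (S k) = (f j == k)}}.

Lemma partner_map_involution b f : partner_map b f -> partial_involution f live.
Proof.
move=> fP j jl; have [fj fjP] := fP _ jl; split=> // fl.
have [_ ffP] := fP _ fl; apply/eqP.
by rewrite -ffP 1?eq_sym // meetsC fjP // eqxx.
Qed.

Lemma covered_pure_blue : covered pure \subset T.
Proof.
apply/bigcupsP=> j; rewrite inE => jp; apply/subsetP=> i ij; apply: contraNT jp => iT.
by apply/meetsP; exists i; rewrite ij (negPf iT).
Qed.

Lemma live_pure_disjoint Y : Y \subset live ->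
  [disjoint covered pure & shade T true (covered Y)].
Proof.
move=> /subsetP Yl; rewrite disjoints_subset; apply/subsetP=> i /bigcupP[k kp ik].
rewrite inE in_shade; apply/negP=> /andP[/bigcupP[j /Yl + ij] iT].
rewrite inE => /and3P[_ _ /forall_inP/(_ k kp)/negP]; apply.
by apply/meetsP; exists i.
Qed.

Section WeightTwo.
Hypothesis weight2 : forall j, #|S j| <= 2.

Lemma card_shade_mixed b j : meets T true (S j) (S j) -> meets T false (S j) (S j) ->
  #|shade T b (S j)| = 1.
Proof.
rewrite /meets setIid -!card_gt0 => blue red.
by have := weight2 j; rewrite -(card_shades T); case: b; lia.
Qed.

Lemma live_shade b j i : j \in live -> i \in shade T b (S j) ->
  shade T b (S j) = [set i].
Proof.
rewrite inE => /and3P[blue red _] ib.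
have /eqP/cards1P[i' e] := card_shade_mixed b blue red.
by move: ib; rewrite e inE => /eqP->.
Qed.

Lemma meets_live b j i X : j \in live -> i \in shade T b (S j) ->
  meets T b (S j) X = (i \in X).
Proof.
move=> jl ij; apply/meetsP/idP => [[i' [i'j i'X i'b]]|iX].
  have : i' \in shade T b (S j) by rewrite in_shade i'j.
  by rewrite (live_shade jl ij) inE => /eqP<-.
by exists i; move: ij; rewrite in_shade => /andP[].
Qed.

Lemma blue_uncovered_live j i : i \in T -> i \notin covered pure -> i \in S j ->
  j \in live.
Proof.
move=> iT ip ij.
have mixed k : i \in S k -> meets T false (S k) (S k).
  by move=> ik; apply: contraNT ip => kp; apply/bigcupP; exists k; rewrite ?inE.
have blue : meets T true (S j) (S j) by apply/meetsP; exists i; rewrite ij iT.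
rewrite inE blue mixed //=; apply/forall_inP=> k.
apply: contraL => /meetsP[i' [i'j i'k i'T]].
rewrite inE negbK mixed //; suff -> : i = i' by [].
have /eqP/cards1P[x e] := card_shade_mixed true blue (mixed _ ij).
have in_x y : y \in S j -> (y \in T) == true -> y = x.
  by move=> yj yT; apply/set1P; rewrite -e in_shade yj.
by rewrite (in_x i) ?iT // (in_x i').
Qed.

Section Fibers.
Variables (b : bool) (Z : {set E}).
Hypothesis Zlive : Z \subset live.

Lemma sum_card_fibers :
  \sum_(i in shade T b (covered Z)) #|[set j in Z | i \in S j]| = #|Z|.
Proof.
under eq_bigr do rewrite -sum1dep_card.
rewrite (exchange_big_dep (mem Z)) /=; last by move=> i j _ /andP[].
rewrite -sum1_card; apply: eq_bigr => j jZ.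
have := subsetP Zlive _ jZ; rewrite inE => /and3P[blue red _].
rewrite sum1dep_card -(card_shade_mixed b blue red); apply: eq_card => i.
rewrite !inE !in_shade jZ /=; have [ij|] := boolP (i \in S j); last by rewrite andbF.
by rewrite andbT; apply: andb_idl => _; apply/bigcupP; exists j.
Qed.

Variable f : E -> E.
Hypothesis fP : partner_map b f.

Lemma fiberE i j : j \in Z -> i \in shade T b (S j) ->
  [set k in Z | i \in S k] = Z :&: [set j; f j].
Proof.
move=> jZ ij; have jl := subsetP Zlive _ jZ; have [_ fjP] := fP jl.
apply/setP=> k; rewrite !inE; have [kZ|//] := boolP (k \in Z); rewrite /=.
have [->|kj] := eqVneq k j; first by move: ij; rewrite in_shade => /andP[].
by rewrite -(meets_live _ jl ij) fjP ?(subsetP Zlive) // eq_sym.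
Qed.

Lemma card_shade_unpaired : {in Z, forall j, f j \notin Z} ->
  #|shade T b (covered Z)| = #|Z|.
Proof.
move=> fZ; rewrite -sum_card_fibers -sum1_card; apply: eq_bigr => i.
rewrite in_shade => /andP[/bigcupP[j jZ ij] ib].
rewrite (fiberE jZ) ?in_shade ?ij // setIUr.
rewrite (setIidPr _) ?sub1set // (disjoint_setI0 _) ?setU0 ?cards1 //.
by rewrite disjoint_sym disjoints1 fZ.
Qed.

Lemma card_shade_paired : {in Z, forall j, f j \in Z} ->
  (#|shade T b (covered Z)|).*2 = #|Z|.
Proof.
move=> fZ; rewrite -sum_card_fibers -muln2 -sum_nat_const; apply: eq_bigr => i.
rewrite in_shade => /andP[/bigcupP[j jZ ij] ib].
rewrite (fiberE jZ) ?in_shade ?ij // (setIidPr _) ?cards2.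
  by have [+ _] := fP (subsetP Zlive _ jZ); rewrite eq_sym => ->.
by rewrite subUset !sub1set jZ fZ.
Qed.

End Fibers.

Variables p q : E -> E.
Hypotheses (pP : partner_map false p) (qP : partner_map true q).

(* Of two live exemplars of [A] sharing their blue feature, only one is kept. *)
Lemma blue_representatives A : exists Z,
  [/\ Z \subset A :&: live, {in Z, forall j, q j \notin Z} &
      shade T true (covered A) \subset covered pure :|: shade T true (covered Z)].
Proof.
pose first j := (q j \in A :&: live) ==> (enum_rank j < enum_rank (q j)).
exists [set j in A :&: live | first j]; split.
- by apply/subsetP=> j; rewrite !inE => /andP[].
- move=> j; rewrite inE => /andP[jAl fj]; rewrite inE; apply/negP=> /andP[qAl].
  have [jl ql] := (subsetP (subsetIr _ _) _ jAl, subsetP (subsetIr _ _) _ qAl).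
  have [_ qqj] := partner_map_involution qP jl.
  by move: fj; rewrite /first qAl (qqj ql) jAl /= => /ltn_trans lt /lt; rewrite ltnn.
apply/subsetP=> i; rewrite in_shade => /andP[/bigcupP[j jA ij] ib].
rewrite inE; have [//|ip] := boolP (i \in covered pure).
rewrite in_shade ib andbT; have jl := blue_uncovered_live (eqP ib) ip ij.
have [fj|] := boolP (first j).
  by apply/bigcupP; exists j; rewrite // inE in_setI jA jl.
rewrite negb_imply -leqNgt => /andP[qAl]; rewrite leq_eqVlt.
have ql := subsetP (subsetIr _ _) _ qAl.
have [[qj qjP] [_ /(_ ql) qqj]] := (qP jl, partner_map_involution qP jl).
rewrite (inj_eq val_inj) (inj_eq enum_rank_inj) (negPf qj) /= => lt_q.
apply/bigcupP; exists (q j).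
  by rewrite inE qAl /first qqj lt_q implybT.
by rewrite -(meets_live (b := true) _ jl) ?qjP ?eqxx // in_shade ij.
Qed.

Lemma leq_double_card_red Z : Z \subset live ->
  (#|Z|).*2 <= (#|shade T false (covered Z)|).*2 + #|[set j in Z | p j \in Z]|.
Proof.
move=> Zl; set Y := [set j in Z | _].
have YZ : Y \subset Z by apply/subsetP=> j; rewrite inE => /andP[].
have [Yl ZYl] := (subset_trans YZ Zl, subset_trans (subsetDl Z Y) Zl).
have pY : {in Y, forall j, p j \in Y}.
  move=> j; rewrite !inE => /andP[jZ pZ].
  have [_ ->] := partner_map_involution pP (subsetP Zl _ jZ); last exact: (subsetP Zl).
  by rewrite pZ.
have pZY : {in Z :\: Y, forall j, p j \notin Z}.
  by move=> j; rewrite !inE => /andP[+ jZ]; rewrite jZ.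
have := card_shade_paired Yl pP pY.
have pZY' : {in Z :\: Y, forall j, p j \notin Z :\: Y}.
  by move=> j /pZY; apply: contra; exact: (subsetP (subsetDl _ _)).
have := card_shade_unpaired ZYl pP pZY'.
have -> : covered Z = covered Y :|: covered (Z :\: Y).
  by rewrite -coveredU -{1}(setIidPr YZ) setID.
have dis : [disjoint shade T false (covered Y) & shade T false (covered (Z :\: Y))].
  rewrite disjoints_subset; apply/subsetP=> i; rewrite in_setC !in_shade.
  case/andP=> /bigcupP[k kY ik] ib; rewrite ib andbT; apply/negP=> /bigcupP[j jZY ij].
  have jl := subsetP ZYl _ jZY; have [_ pjP] := pP jl.
  have kj : k != j by apply: contraTneq kY => ->; case/setDP: jZY.
  case/negP: (pZY _ jZY); suff /eqP-> : p j == k by exact: (subsetP YZ).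
  by rewrite -pjP ?(subsetP Yl) // (meets_live _ jl (i := i)) // in_shade ij.
move: dis; rewrite shadeU -leq_card_setU => /eqP->.
have := cardsID Y Z; rewrite (setIidPr YZ).
lia.
Qed.

Lemma margin_upper_bound A : exists2 Y, matching p q live Y &
  (#|shade T true (covered A)|).*2 <=
  (#|shade T false (covered A)|).*2 + (#|covered pure|).*2 + #|Y|.
Proof.
have [Z [ZAl qZ blue]] := blue_representatives A.
have ZA : Z \subset A := subset_trans ZAl (subsetIl _ _).
have Zl : Z \subset live := subset_trans ZAl (subsetIr _ _).
set Y := [set j in Z | p j \in Z].
have inY j : (j \in Y) = (j \in Z) && (p j \in Z) by rewrite in_set.
exists Y.
  move=> j; rewrite !inY => /andP[jZ pZ]; have jl := subsetP Zl _ jZ.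
  have [_ ->] := partner_map_involution pP jl; rewrite ?(subsetP Zl) //.
  by rewrite jZ pZ (negPf (qZ _ jZ)).
have := leq_trans (subset_leq_card blue) (leq_card_setU _ _).
rewrite (card_shade_unpaired Zl qP qZ).
have := leq_double_card_red Zl; rewrite -/Y.
have := subset_leq_card (shadeS T false (coveredS ZA)).
lia.
Qed.

Lemma margin_lower_bound Y : matching p q live Y ->
  (#|shade T false (covered (pure :|: Y))|).*2 + (#|covered pure|).*2 + #|Y| <=
  (#|shade T true (covered (pure :|: Y))|).*2.
Proof.
move=> mY; have Yl := matching_subset mY.
rewrite coveredU !shadeU.
have -> : shade T true (covered pure) = covered pure by exact/setIidPl/covered_pure_blue.
have -> : shade T false (covered pure) = set0.
  by apply/eqP; rewrite /= setD_eq0 covered_pure_blue.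
move: (live_pure_disjoint Yl); rewrite -leq_card_setU set0U => /eqP->.
have := card_shade_unpaired Yl qP (fun j jY => let: And3 _ _ qY := mY j jY in qY).
have := card_shade_paired Yl pP (fun j jY => let: And3 _ pY _ := mY j jY in pY).
lia.
Qed.

Lemma maximum_matching_margin Y A : maximum_matching p q live Y ->
  #|shade T true (covered A)| + #|shade T false (covered (pure :|: Y))| <=
  #|shade T true (covered (pure :|: Y))| + #|shade T false (covered A)|.
Proof.
move=> [mY maxY]; have [Z /maxY cZ] := margin_upper_bound A.
by have := margin_lower_bound mY; lia.
Qed.

End WeightTwo.
End Exemplars.

(** * Structured machine code *)

Inductive code : Type :=
| Block of seq instr
| Seq of code & code
| If of nat & code & code
| While of nat & code.

Definition basic (i : instr) : bool :=
  match i with IJz _ _ | IJmp _ => false | _ => true end.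

Definition exec_instr (M : memory) (i : instr) : memory :=
  match i with
  | IConst r v => upd M r v
  | IAdd r a b => upd M r (M a + M b)
  | ISub r a b => upd M r (M a - M b)
  | ILoad r a => upd M r (M (M a))
  | IStore a r => upd M (M a) (M r)
  | _ => M
  end.

Notation exec_block := (foldl exec_instr).

Fixpoint code_size (c : code) : nat :=
  match c with
  | Block l => size l
  | Seq c1 c2 => code_size c1 + code_size c2
  | If _ c1 c2 => (code_size c1 + code_size c2).+2
  | While _ c => (code_size c).+2
  end.

Fixpoint assemble (pc : nat) (c : code) : seq instr :=
  match c with
  | Block l => l
  | Seq c1 c2 => assemble pc c1 ++ assemble (pc + code_size c1) c2
  | If r c1 c2 =>
      IJz r (pc + code_size c1).+2 :: assemble pc.+1 c1 ++
      IJmp (pc + code_size c1 + code_size c2).+2 :: assemble (pc + code_size c1).+2 c2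
  | While r c =>
      IJz r (pc + code_size c).+2 :: assemble pc.+1 c ++ [:: IJmp pc]
  end.

Lemma size_assemble c pc : size (assemble pc c) = code_size c.
Proof.
elim: c pc => [l|c1 IH1 c2 IH2|r c1 IH1 c2 IH2|r c IH] pc //=.
- by rewrite size_cat IH1 IH2.
- by rewrite size_cat /= IH1 IH2 addnS.
- by rewrite size_cat /= IH addn1.
Qed.

Definition code_at (p : seq instr) (pc : nat) (l : seq instr) : Prop :=
  exists pre post, p = pre ++ l ++ post /\ size pre = pc.

Lemma code_at_cat p pc l1 l2 :
  code_at p pc (l1 ++ l2) -> code_at p pc l1 /\ code_at p (pc + size l1) l2.
Proof.
move=> [pre [post [-> <-]]]; split; first by exists pre, (l2 ++ post); rewrite !catA.
by exists (pre ++ l1), post; rewrite !catA size_cat.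
Qed.

Lemma code_at_cons p pc i l :
  code_at p pc (i :: l) -> code_at p pc [:: i] /\ code_at p pc.+1 l.
Proof. by move=> /(@code_at_cat p pc [:: i] l); rewrite addn1. Qed.

Lemma run_instr p pc i f M : code_at p pc [:: i] ->
  run f.+1 p pc M =
    match i with
    | IJz r l => run f p (if M r == 0 then l else pc.+1) M
    | IJmp l => run f p l M
    | _ => run f p pc.+1 (exec_instr M i)
    end.
Proof.
move=> [pre [post [-> <-]]] /=.
rewrite size_cat /= leqNgt addnS ltnS leq_addr /= /step nth_cat ltnn subnn /=.
by case: i.
Qed.

Arguments run : simpl never.

Lemma run_block p l : all basic l -> forall pc f M, code_at p pc l ->
  run (size l + f) p pc M = run f p (pc + size l) (exec_block M l).
Proof.
elim: l => [|i l IH] /= => [_ pc f M _|/andP[bi bl] pc f M /code_at_cons[ci cl]].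
  by rewrite addn0.
rewrite addSn (run_instr _ _ ci) addnS -addSn -IH //.
by case: i bi {ci}.
Qed.

Section Halting.
Implicit Types (c : code) (M : memory) (t : nat) (Q : memory -> Prop).

Definition halts c M t Q : Prop :=
  exists t' M', [/\ t' <= t, Q M' & forall p pc f, code_at p pc (assemble pc c) ->
    run (t' + f) p pc M = run f p (pc + code_size c) M'].

Lemma halts_run c M t Q : halts c M t Q ->
  exists2 M', run t (assemble 0 c) 0 M = Some M' & Q M'.
Proof.
move=> [t' [M' [/subnKC <- QM' runE]]]; exists M' => //.
rewrite runE; last by exists [::], [::]; rewrite cats0.
by case: (t - t') => [|f]; rewrite /run size_assemble add0n leqnn.
Qed.

Lemma halts_weaken c M t t' Q Q' : t <= t' -> (forall M', Q M' -> Q' M') ->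
  halts c M t Q -> halts c M t' Q'.
Proof.
move=> tt' QQ' [u [M' [ut QM' runE]]].
by exists u, M'; split; [exact: leq_trans tt'|exact: QQ'|].
Qed.

Lemma halts_block l M Q : all basic l -> Q (exec_block M l) ->
  halts (Block l) M (size l) Q.
Proof.
by move=> bl QM; exists (size l), (exec_block M l); split=> // *; exact: run_block.
Qed.

Lemma halts_seq c1 c2 M t1 t2 Q1 Q2 : halts c1 M t1 Q1 ->
  (forall M1, Q1 M1 -> halts c2 M1 t2 Q2) -> halts (Seq c1 c2) M (t1 + t2) Q2.
Proof.
move=> [u1 [M1 [le1 QM1 run1]]] /(_ _ QM1)[u2 [M2 [le2 QM2 run2]]].
exists (u1 + u2), M2; split=> //; first exact: leq_add.
move=> p pc f /= /code_at_cat[at1]; rewrite size_assemble => at2.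
by rewrite -addnA run1 // run2 // addnA.
Qed.

Lemma halts_if r c1 c2 M t Q : (M r != 0 -> halts c1 M t Q) ->
  (M r = 0 -> halts c2 M t Q) -> halts (If r c1 c2) M t.+2 Q.
Proof.
move=> h1 h2; have [Mr0|Mr] := eqVneq (M r) 0.
  have [u [M' [ut QM' runE]]] := h2 Mr0; exists u.+1, M'; split=> //.
    by rewrite ltnS ltnW.
  move=> p pc f /= /code_at_cons[at_jz /code_at_cat[_]].
  rewrite size_assemble => /code_at_cons[_ at2].
  rewrite (run_instr (u + f) M at_jz) Mr0 eqxx runE //.
  by rewrite !addnS !addSn addnA.
have [u [M' [ut QM' runE]]] := h1 Mr; exists u.+2, M'; split=> //.
move=> p pc f /= /code_at_cons[at_jz /code_at_cat[at1]].
rewrite size_assemble => /code_at_cons[at_jmp _].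
rewrite (run_instr (u.+1 + f) M at_jz) (negPf Mr) addSnnS runE //.
by rewrite (run_instr _ _ at_jmp) !addnS addnA.
Qed.

Lemma halts_while (I : nat -> memory -> Prop) r c t :
  (forall k M, I k M -> M r = k) ->
  (forall k M, I k.+1 M -> halts c M t (I k)) ->
  forall k M, I k M -> halts (While r c) M (k * t.+2 + 1) (I 0).
Proof.
move=> Ir body; elim=> [|k IH] M IM.
  exists 1, M; split=> // p pc f /= /code_at_cons[at_jz _].
  by rewrite add1n (run_instr _ _ at_jz) (Ir _ _ IM) !addnS.
have [u1 [M1 [le1 /IH[u2 [M2 [le2 IM2 run2]]] run1]]] := body _ _ IM.
exists (u1 + u2).+2, M2; split=> //; first by lia.
move=> p pc f /= at_while; have [at_jz /code_at_cat[at_c]] := code_at_cons at_while.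
rewrite size_assemble => at_jmp.
rewrite !addSn -addnS (run_instr _ _ at_jz) (Ir _ _ IM) /= addnS -addnA -addnS run1 //.
by rewrite (run_instr _ _ at_jmp) run2.
Qed.

End Halting.

(** * A language with counting loops and arrays *)

Inductive cmd : Type :=
| Skip
| Const of nat & nat
| Plus of nat & nat & nat
| Minus of nat & nat & nat
| Get of nat & nat & nat
| Put of nat & nat & nat
| Then of cmd & cmd
| Cond of nat & cmd & cmd
| For of nat & nat & cmd.

Notation "c1 ;; c2" := (Then c1 c2) (at level 60, right associativity).

Record state := State { vars : nat -> nat; arrays : nat -> nat -> nat }.

Definition set_var (s : state) (v x : nat) : state := State (upd (vars s) v x) (arrays s).

Definition set_array (s : state) (a i x : nat) : state :=
  State (vars s) (fun b => if b == a then upd (arrays s a) i x else arrays s b).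

Fixpoint countdown (f : state -> state) (u k : nat) (s : state) : state :=
  if k is k'.+1 then countdown f u k' (f (set_var s u k')) else s.

Fixpoint eval (c : cmd) (s : state) : state :=
  match c with
  | Skip => s
  | Const v k => set_var s v k
  | Plus v a b => set_var s v (vars s a + vars s b)
  | Minus v a b => set_var s v (vars s a - vars s b)
  | Get v a i => set_var s v (arrays s a (vars s i))
  | Put a i v => set_array s a (vars s i) (vars s v)
  | c1 ;; c2 => eval c2 (eval c1 s)
  | Cond v c1 c2 => if vars s v != 0 then eval c1 s else eval c2 s
  | For u b c => countdown (eval c) u (vars s b) (set_var s u (vars s b))
  end.

Fixpoint writes_var (v : nat) (c : cmd) : bool :=
  match c with
  | Skip | Put _ _ _ => false
  | Const u _ | Plus u _ _ | Minus u _ _ | Get u _ _ => u == v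
  | c1 ;; c2 | Cond _ c1 c2 => writes_var v c1 || writes_var v c2
  | For u _ c => (u == v) || writes_var v c
  end.

Fixpoint writes_array (a : nat) (c : cmd) : bool :=
  match c with
  | Put b _ _ => b == a
  | c1 ;; c2 | Cond _ c1 c2 => writes_array a c1 || writes_array a c2
  | For _ _ c => writes_array a c
  | _ => false
  end.

Lemma vars_set_var s v x u : vars (set_var s v x) u = if u == v then x else vars s u.
Proof. by []. Qed.

Lemma arrays_set_array s a i x b k :
  arrays (set_array s a i x) b k = if (b == a) && (k == i) then x else arrays s b k.
Proof. by rewrite /set_array /=; case: eqP => [->|//]; rewrite /upd. Qed.

Definition agree_off (c : cmd) (s s' : state) : Prop :=
  (forall v, ~~ writes_var v c -> vars s' v = vars s v) /\
  (forall a, ~~ writes_array a c -> arrays s' a = arrays s a).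

Lemma agree_off_refl c s : agree_off c s s.
Proof. by []. Qed.

Lemma agree_off_trans c s1 s2 s3 : agree_off c s1 s2 -> agree_off c s2 s3 ->
  agree_off c s1 s3.
Proof.
move=> [v12 a12] [v23 a23]; split=> [v cv|a ca]; first by rewrite v23 ?v12.
by rewrite a23 ?a12.
Qed.

Lemma agree_off_sub c c' s s' :
  (forall v, writes_var v c -> writes_var v c') ->
  (forall a, writes_array a c -> writes_array a c') ->
  agree_off c s s' -> agree_off c' s s'.
Proof.
move=> sv sa [ev ea]; split=> [v|a] h; [apply: ev|apply: ea].
  exact: contra (sv v) h.
exact: contra (sa a) h.
Qed.

Lemma agree_off_set_var c s v x : writes_var v c -> agree_off c s (set_var s v x).
Proof.
by move=> cv; split=> // u; rewrite vars_set_var; case: eqP => // ->; rewrite cv.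
Qed.

Lemma agree_off_eval c s : agree_off c s (eval c s).
Proof.
elim: c s => [|v k|v a b|v a b|v a i|a i v|c1 IH1 c2 IH2|v c1 IH1 c2 IH2|u b c IH] s /=.
- exact: agree_off_refl.
1-4: by apply: agree_off_set_var; rewrite /= eqxx.
- by split=> //= b; rewrite eq_sym => /negPf->.
- by apply: agree_off_trans; apply: agree_off_sub (IH1 _) || apply: agree_off_sub (IH2 _);
    move=> x /= ->; rewrite ?orbT.
- by case: ifP => _; [apply: agree_off_sub (IH1 _)|apply: agree_off_sub (IH2 _)];
    move=> x /= ->; rewrite ?orbT.
have set_u s' x : agree_off (For u b c) s' (set_var s' u x).
  by apply: agree_off_set_var; rewrite /= eqxx.
apply: agree_off_trans (set_u s (vars s b)) _.
elim: (vars s b) (set_var _ _ _) => [|k IHk] s' /=; first exact: agree_off_refl.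
apply: agree_off_trans (set_u s' k) _; apply: agree_off_trans (IHk _).
by apply: agree_off_sub (IH _) => x /= ->; rewrite ?orbT.
Qed.

Lemma vars_eval c s v : ~~ writes_var v c -> vars (eval c s) v = vars s v.
Proof. by case: (agree_off_eval c s) => + _; apply. Qed.

Lemma arrays_eval c s a : ~~ writes_array a c -> arrays (eval c s) a = arrays s a.
Proof. by case: (agree_off_eval c s) => _; apply. Qed.

Lemma for_ind (I : nat -> state -> Prop) u b c s :
  I (vars s b) (set_var s u (vars s b)) ->
  (forall k s', k < vars s b -> agree_off (For u b c) s (set_var s' u k) ->
     I k.+1 s' -> I k (eval c (set_var s' u k))) ->
  I 0 (eval (For u b c) s).
Proof.
move=> I0 step /=; set loop := For u b c in step *.
have set_u s' x : agree_off loop s' (set_var s' u x).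
  by apply: agree_off_set_var; rewrite /= eqxx.
have gen k s' : k <= vars s b -> agree_off loop s s' -> I k s' ->
    I 0 (countdown (eval c) u k s').
  elim: k s' => [|k IH] s' //= kb ss' Ik; have {}ss' := agree_off_trans ss' (set_u s' k).
  apply: IH; [exact: ltnW| |exact: step].
  apply: agree_off_trans ss' _.
  by apply: agree_off_sub (agree_off_eval c _) => x /= ->; rewrite ?orbT.
exact: gen.
Qed.

(** * Compilation to machine code *)

(* Machine registers 0 to 3 hold the constant 1, the base address and two
   temporaries. *)
Definition nvars := 20.
Definition reg (v : nat) := v + 4.
Definition cell (base a i : nat) := base + 8 * i + a.

Definition address (a i : nat) : seq instr :=
  [:: IAdd 2 (reg i) (reg i); IAdd 2 2 2; IAdd 2 2 2; IAdd 2 2 1;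
      IConst 3 a; IAdd 2 2 3].

Fixpoint compile (c : cmd) : code :=
  match c with
  | Skip => Block [::]
  | Const v k => Block [:: IConst (reg v) k]
  | Plus v a b => Block [:: IAdd (reg v) (reg a) (reg b)]
  | Minus v a b => Block [:: ISub (reg v) (reg a) (reg b)]
  | Get v a i => Block (rcons (address a i) (ILoad (reg v) 2))
  | Put a i v => Block (rcons (address a i) (IStore 2 (reg v)))
  | c1 ;; c2 => Seq (compile c1) (compile c2)
  | Cond v c1 c2 => If (reg v) (compile c1) (compile c2)
  | For u b c =>
      Seq (Block [:: IAdd (reg u) (reg b) 0; ISub (reg u) (reg u) 0])
          (While (reg u) (Seq (Block [:: ISub (reg u) (reg u) 0]) (compile c)))
  end.

Fixpoint well_formed (c : cmd) : bool :=
  match c with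
  | Skip => true
  | Const v _ => v < nvars
  | Plus v a b | Minus v a b => [&& v < nvars, a < nvars & b < nvars]
  | Get v a i | Put a i v => [&& v < nvars, a < 8 & i < nvars]
  | c1 ;; c2 => well_formed c1 && well_formed c2
  | Cond v c1 c2 => [&& v < nvars, well_formed c1 & well_formed c2]
  | For u b c => [&& u < nvars, b < nvars, ~~ writes_var u c & well_formed c]
  end.

Fixpoint bounds_fixed (bs : seq nat) (c : cmd) : bool :=
  match c with
  | c1 ;; c2 | Cond _ c1 c2 => bounds_fixed bs c1 && bounds_fixed bs c2
  | For u b c => [&& b \in bs, u \notin bs & bounds_fixed bs c]
  | Const v _ | Plus v _ _ | Minus v _ _ | Get v _ _ => v \notin bs
  | Skip | Put _ _ _ => true
  end.

Lemma bounds_fixed_writes bs c v : bounds_fixed bs c -> v \in bs -> ~~ writes_var v c.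
Proof.
move=> + vb; elim: c => //=; try by move=> u *; apply: contraTneq vb => <-.
- by move=> c1 IH1 c2 IH2 /andP[? ?]; rewrite negb_or IH1 ?IH2.
- by move=> u c1 IH1 c2 IH2 /andP[? ?]; rewrite negb_or IH1 ?IH2.
- move=> u b c IH /and3P[_ ub h]; rewrite negb_or IH // andbT.
  by apply: contraNneq ub => ->.
Qed.

(* Bounds the running time when no loop bound exceeds [B]. *)
Fixpoint cost (B : nat) (c : cmd) : nat :=
  match c with
  | Skip => 0
  | Const _ _ | Plus _ _ _ | Minus _ _ _ => 1
  | Get _ _ _ | Put _ _ _ => 7
  | c1 ;; c2 => cost B c1 + cost B c2
  | Cond _ c1 c2 => (cost B c1 + cost B c2).+2
  | For _ _ c => B * (cost B c).+3 + 3
  end.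

Fixpoint depth (c : cmd) : nat :=
  match c with
  | c1 ;; c2 | Cond _ c1 c2 => maxn (depth c1) (depth c2)
  | For _ _ c => (depth c).+1
  | _ => 0
  end.

Lemma cost_polynomial c B : cost B c <= cost 1 c * B.+1 ^ depth c.
Proof.
have pos k : 0 < B.+1 ^ k by rewrite expn_gt0.
have widen k l x y : k <= l -> x <= y * B.+1 ^ k -> x <= y * B.+1 ^ l.
  by move=> kl /leq_trans; apply; rewrite leq_mul2l leq_pexp2l // orbT.
elim: c => [|v k|v a b|v a b|v a i|a i v|c1 IH1 c2 IH2|v c1 IH1 c2 IH2|u b c IH] //=.
- rewrite mulnDl leq_add //; [apply: widen IH1|apply: widen IH2].
    exact: leq_maxl.
  exact: leq_maxr.
- have := widen _ _ _ _ (leq_maxl _ (depth c2)) IH1.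
  have := widen _ _ _ _ (leq_maxr (depth c1) _) IH2.
  have := pos (maxn (depth c1) (depth c2)); move: (_ ^ _) => P; nia.
- have := pos (depth c); rewrite expnS mul1n; move: (_ ^ _) IH => P; nia.
Qed.

Definition represents (base : nat) (s : state) (M : memory) : Prop :=
  [/\ M 0 = 1, M 1 = base, forall v, v < nvars -> M (reg v) = vars s v &
      forall a i, a < 8 -> M (cell base a i) = arrays s a i].

Section Simulation.
Variable base : nat.
Hypothesis base_ge : reg nvars <= base.

Lemma represents_set_var s M v x : v < nvars -> represents base s M ->
  represents base (set_var s v x) (upd M (reg v) x).
Proof.
rewrite /reg => vn [M0 M1 Mv Ma]; rewrite /upd; split=> //=.
- by rewrite addn4.
- by rewrite addn4.
- by move=> u un; rewrite eqn_add2r /upd Mv.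
- move=> a i a8; case: eqP => [e|_]; last exact: Ma.
  by have := base_ge; rewrite /reg /nvars /cell in vn e *; lia.
Qed.

Lemma represents_temporary s M r x : 1 < r < 4 -> represents base s M ->
  represents base s (upd M r x).
Proof.
move=> rr [M0 M1 Mv Ma]; rewrite /upd; split=> //=.
- by case: eqP => // e; lia.
- by case: eqP => // e; lia.
- by move=> v vn; rewrite /reg; case: eqP => [e|_]; [lia|exact: Mv].
- move=> a i a8; case: eqP => [e|_]; last exact: Ma.
  by have := base_ge; rewrite /reg /nvars /cell in e *; lia.
Qed.

Lemma represents_set_array s M a i x : a < 8 -> represents base s M ->
  represents base (set_array s a i x) (upd M (cell base a i) x).
Proof.
have bg : 24 <= base := base_ge.
rewrite /cell => a8 [M0 M1 Mv Ma]; rewrite /upd; split.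
- by case: eqP => // e; lia.
- by case: eqP => // e; lia.
- by move=> v vn; case: eqP => [|_]; [rewrite /reg /nvars in vn *; lia|exact: Mv].
move=> b k b8; rewrite arrays_set_array /cell.
case: eqP => [e|ne]; last by case: andP => [[/eqP eb /eqP ek]|_]; [lia|exact: Ma].
have [-> ->] : b = a /\ k = i by lia.
by rewrite !eqxx.
Qed.

Lemma address_correct s M a i : a < 8 -> i < nvars -> represents base s M ->
  let M' := exec_block M (address a i) in
  represents base s M' /\ M' 2 = cell base a (vars s i).
Proof.
move=> a8 iN R M'; split; last first.
  have [_ M1 Mv _] := R.
  by rewrite /M' /address /cell /= /upd /= M1 Mv //; lia.
by rewrite /M' /address /=; do !apply: represents_temporary.
Qed.

Variables (bs : seq nat) (B : nat).

Definition bounded (s : state) : Prop := {in bs, forall b, vars s b <= B}.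

Lemma bounded_eval c s : bounds_fixed bs c -> bounded s -> bounded (eval c s).
Proof. by move=> fc sB b bb; rewrite vars_eval ?(bounds_fixed_writes fc) // sB. Qed.

Lemma bounded_set_var s v x : v \notin bs -> bounded s -> bounded (set_var s v x).
Proof.
move=> vb sB b bb; rewrite vars_set_var; case: eqP => [e|_]; last exact: sB.
by rewrite -e bb in vb.
Qed.

Definition simulates (c : code) (f : state -> state) (t : nat) : Prop :=
  forall s M, represents base s M -> bounded s -> halts c M t (represents base (f s)).

Lemma simulates_block l f :
  all basic l ->
  (forall s M, represents base s M -> represents base (f s) (exec_block M l)) ->
  simulates (Block l) f (size l).
Proof. by move=> bl fl s M R _; apply: halts_block => //; exact: fl. Qed.

Lemma simulates_loop u c f t : u < nvars -> u \notin bs ->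
  simulates c f t -> (forall s, vars (f s) u = vars s u) ->
  (forall s, bounded s -> bounded (f s)) ->
  forall k s M, represents base s M -> bounded s -> vars s u = k ->
  halts (While (reg u) (Seq (Block [:: ISub (reg u) (reg u) 0]) c)) M (k * t.+3 + 1)
    (represents base (countdown f u k s)).
Proof.
move=> un ub cf fu fB k s M R sB su.
pose I j M' := exists s', [/\ represents base s' M', bounded s', vars s' u = j &
  countdown f u j s' = countdown f u k s].
apply: (halts_weaken (leqnn _)) (halts_while (I := I) (t := t.+1) _ _ _).
- by move=> M' [s' [R' _ _ <-]].
- by move=> j M' [s' [[_ _ Mv _] _ <- _]]; rewrite Mv.
- move=> j M' [s' [R' sB' su' e']]; have [M0 _ Mv _] := R'.
  rewrite -[t.+1]add1n.
  apply: halts_seq (halts_block (Q := represents base (set_var s' u j)) _ _) _.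
  + by [].
  + rewrite /= M0 Mv // su' subn1; exact: represents_set_var.
  move=> M1 R1; apply: halts_weaken (cf _ _ R1 (bounded_set_var _ ub sB')) => // M2 R2.
  exists (f (set_var s' u j)); split=> //.
    exact/fB/bounded_set_var.
  by rewrite fu vars_set_var eqxx.
- by exists s.
Qed.

Lemma simulates_for u b c : u < nvars -> b < nvars -> b \in bs -> u \notin bs ->
  ~~ writes_var u c -> bounds_fixed bs c -> simulates (compile c) (eval c) (cost B c) ->
  simulates (compile (For u b c)) (eval (For u b c)) (cost B (For u b c)).
Proof.
move=> un bn bb ub uc fc cf s M R sB; have [M0 _ Mv _] := R.
set init := [:: IAdd (reg u) (reg b) 0; ISub (reg u) (reg u) 0].
have Rinit : represents base (set_var s u (vars s b)) (exec_block M init).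
  have R' := represents_set_var (vars s b + 1) un R; have [M'0 _ M'v _] := R'.
  rewrite [exec_block _ _]/= M0 Mv // M'v // M'0 vars_set_var eqxx addnK.
  have [? ? hv ?] := represents_set_var (vars s b) un R'.
  by split=> // v /hv->; rewrite !vars_set_var; case: eqP.
have u_init : vars (set_var s u (vars s b)) u = vars s b by rewrite vars_set_var eqxx.
have loop := simulates_loop un ub cf (fun s => vars_eval s uc) (fun s => bounded_eval fc)
  Rinit (bounded_set_var _ ub sB) u_init.
apply: (halts_weaken (t := 2 + (vars s b * (cost B c).+3 + 1)) _ (fun _ => id)).
  have := sB _ bb; rewrite /=; nia.
apply: halts_seq (halts_block (l := init) (Q := eq (exec_block M init)) isT erefl) _.
by move=> M1 <-.
Qed.

Lemma compile_correct c : well_formed c -> bounds_fixed bs c ->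
  simulates (compile c) (eval c) (cost B c).
Proof.
elim: c => [|v k|v a b|v a b|v a i|a i v|c1 IH1 c2 IH2|v c1 IH1 c2 IH2|u b c IH] /=.
- by move=> _ _; apply: simulates_block.
- by move=> vn _; apply: (@simulates_block [:: _]) => // s M; exact: represents_set_var.
- move=> /and3P[vn an bn] _; apply: (@simulates_block [:: _]) => // s M R.
  by have [_ _ Mv _] := R; rewrite /= !Mv //; exact: represents_set_var.
- move=> /and3P[vn an bn] _; apply: (@simulates_block [:: _]) => // s M R.
  by have [_ _ Mv _] := R; rewrite /= !Mv //; exact: represents_set_var.
- move=> /and3P[vn a8 iN] _; apply: simulates_block => // s M R.
  have [] := address_correct a8 iN R; set M' := exec_block M (address a i) => R' M'2.
  have [_ _ _ Ma] := R'; rewrite -[exec_block _ _]/(upd M' (reg v) (M' (M' 2))) M'2 Ma //.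
  exact: represents_set_var.
- move=> /and3P[vn a8 iN] _; apply: simulates_block => // s M R.
  have [] := address_correct a8 iN R; set M' := exec_block M (address a i) => R' M'2.
  have [_ _ Mv _] := R'; rewrite -[exec_block _ _]/(upd M' (M' 2) (M' (reg v))) M'2 Mv //.
  exact: represents_set_array.
- move=> /andP[w1 w2] /andP[f1 f2] s M R sB.
  apply: halts_seq (IH1 w1 f1 _ _ R sB) _ => M1 R1.
  exact: IH2 R1 (bounded_eval f1 sB).
- move=> /and3P[vn w1 w2] /andP[f1 f2] s M R sB; have [_ _ Mv _] := R.
  apply: halts_if; rewrite Mv //.
  + by move=> ->; apply: halts_weaken (IH1 w1 f1 _ _ R sB); rewrite ?leq_addr.
  + by move=> ->; apply: halts_weaken (IH2 w2 f2 _ _ R sB); rewrite ?leq_addl.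
- move=> /and4P[un bn uc wc] /and3P[bb ub fc].
  by apply: simulates_for => //; exact: IH.
Qed.

End Simulation.

(** * Relocating the input *)

Lemma updE M r v : upd M r v r = v.
Proof. by rewrite /upd eqxx. Qed.

Lemma upd_neq M r v x : x <> r -> upd M r v x = M x.
Proof. by rewrite /upd => /eqP/negPf->. Qed.

(* No low cell is known to be free, so the program keeps the bits of the first cells
   in its control state while these cells serve as registers. *)
Fixpoint with_bits (rs : seq nat) (f : seq bool -> code) : code :=
  if rs is r :: rs' then
    If r (with_bits rs' (fun bits => f (true :: bits)))
         (with_bits rs' (fun bits => f (false :: bits)))
  else f [::].

Lemma halts_with_bits rs f M t Q : halts (f [seq M r != 0 | r <- rs]) M t Q ->
  halts (with_bits rs f) M (t + 2 * size rs) Q.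
Proof.
elim: rs f => [|r rs IH] f /=; first by rewrite addn0.
have -> : t + 2 * (size rs).+1 = (t + 2 * size rs).+2 by lia.
by move=> h; apply: halts_if => Mr; apply: IH; rewrite Mr in h.
Qed.

(* Register 0 points to the last cell written and register 3 holds the stride. *)
Definition save_cell (r : nat) : seq instr := [:: IAdd 0 0 3; IStore 0 r].

Definition save_bit (b : bool) : seq instr := IConst 1 b :: save_cell 1.

Definition low_cells : seq nat := iota 2 6.

(* Registers 0 and 1 hold the sizes [n] and [m], and register 4 receives the base
   address [24 + n + m + m * n]. *)
Definition save_low (bits : seq bool) : code :=
  Seq (Block [:: IConst 2 1; IConst 4 24; IAdd 4 4 0; IAdd 4 4 1; IAdd 3 1 2; ISub 3 3 2])
  (Seq (While 3 (Block [:: ISub 3 3 2; IAdd 4 4 0]))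
       (Block ([:: IStore 4 0; IAdd 0 4 3; IConst 3 8] ++ save_cell 1 ++
               flatten [seq save_bit b | b <- bits]))).

(* Register 5 counts the cells still to be copied, register 6 points to the next one. *)
Definition save_next : seq instr :=
  [:: ISub 5 5 2; ILoad 7 6; IAdd 0 0 3; IStore 0 7; IAdd 6 6 2].

Definition boot : code :=
  Seq (with_bits low_cells save_low)
  (Seq (Block [:: IConst 6 8; ISub 5 4 6])
  (Seq (While 5 (Block save_next))
       (Block [:: IConst 3 0; IAdd 1 4 3; IConst 0 1]))).

Section Boot.
Variables n m : nat.

(* Above the machine registers and the encoded input. *)
Definition heap_base := 24 + n + m + m * n.
Local Notation base := heap_base.

Lemma heap_base_ge : 24 <= base.
Proof. by rewrite /heap_base -!addnA leq_addr. Qed.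

Variable enc : memory.
Hypotheses (enc0 : enc 0 = n) (enc1 : enc 1 = m).
Hypothesis enc_bit : forall x, 1 < x -> enc x <= 1.
Hypothesis enc_end : forall x, 2 + n + m * n <= x -> enc x = 0.

Definition saved (x : nat) (M : memory) : Prop := forall y a, a < 8 ->
  M (cell base a y) = if (a == 0) && (y < x) then enc y else 0.

Definition saving (x : nat) (M : memory) : Prop :=
  [/\ M 0 + 8 = cell base 0 x, M 2 = 1 /\ M 3 = 8, M 4 = base, saved x M &
      forall z, 8 <= z < base -> M z = enc z].

Lemma saved0 : saved 0 enc.
Proof. by move=> y a a8; rewrite andbF enc_end // /cell /heap_base; lia. Qed.

Lemma saved_low x M r v : r < base -> saved x M -> saved x (upd M r v).
Proof. by move=> rb sM y a a8; rewrite upd_neq ?sM // /cell; lia. Qed.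

Lemma saved_store x M : saved x M -> saved x.+1 (upd M (cell base 0 x) (enc x)).
Proof.
move=> sM y a a8; rewrite /upd; case: eqP => [|ne].
  rewrite /cell => e; have [-> ->] : a = 0 /\ y = x by lia.
  by rewrite ltnSn.
rewrite sM // [y < x.+1]ltnS [y <= x]leq_eqVlt; case: eqP => //= a0.
by case: eqP => // yx; rewrite a0 yx in ne.
Qed.

Lemma saving_save_cell x M r : 0 < r < base -> M r = enc x -> saving x M ->
  saving x.+1 (exec_block M (save_cell r)).
Proof.
move=> /andP[r0 rb] Mr [M0 [M2 M3] M4 sM Mz]; have bg := heap_base_ge.
pose M' := upd (upd M 0 (cell base 0 x)) (cell base 0 x) (enc x).
have -> : exec_block M (save_cell r) = M'.
  by rewrite /= M3 M0 updE upd_neq ?Mr //; lia.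
have off z : 0 < z < base -> M' z = M z.
  by move=> zb; rewrite /M' !upd_neq // /cell; lia.
split.
- by rewrite /M' upd_neq ?updE /cell; lia.
- by rewrite !off ?M2 ?M3; lia.
- by rewrite off ?M4; lia.
- by apply: saved_store; apply: saved_low => //; lia.
- by move=> z zb; rewrite off ?Mz //; lia.
Qed.

Lemma saving_upd x M r v : r \in [:: 1; 5; 6; 7] -> saving x M -> saving x (upd M r v).
Proof.
have bg := heap_base_ge.
move=> rr [M0 [M2 M3] M4 sM Mz].
have [r0 r2 r3 r4] : [/\ 0 <> r, 2 <> r, 3 <> r & 4 <> r].
  by move: rr; rewrite !inE; split; lia.
have r8 : r < 8 by move: rr; rewrite !inE; lia.
split; rewrite ?upd_neq //; first by apply: saved_low sM; lia.
by move=> z zb; rewrite upd_neq ?Mz //; lia.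
Qed.

Lemma saving_save_bits bits x M :
  (forall i, i < size bits -> enc (x + i) = nth false bits i) -> saving x M ->
  saving (x + size bits) (exec_block M (flatten [seq save_bit b | b <- bits])).
Proof.
have bg := heap_base_ge.
elim: bits x M => [|b bits IH] x M encE sM /=; first by rewrite addn0.
rewrite addnS -addSn -/save_bit; apply: IH.
  by move=> i ib; rewrite -(encE i.+1) // addnS.
apply: (@saving_save_cell x (upd M 1 b) 1).
- by lia.
- by rewrite updE -(encE 0) // addn0.
- exact: saving_upd.
Qed.

Definition base_computed (M : memory) : Prop :=
  [/\ M 0 = n /\ M 1 = m, M 3 = 0, M 2 = 1 /\ M 4 = base, saved 0 M &
      forall z, 8 <= z -> M z = enc z].

Lemma saving_sizes M : base_computed M ->
  saving 2 (exec_block M ([:: IStore 4 0; IAdd 0 4 3; IConst 3 8] ++ save_cell 1)).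
Proof.
move=> [[M0 M1] M3 [M2 M4] sM Mz]; have bg := heap_base_ge.
rewrite foldl_cat; set M' := exec_block M [:: IStore 4 0; IAdd 0 4 3; IConst 3 8].
have M'E : M' = upd (upd (upd M (cell base 0 0) (enc 0)) 0 base) 3 8.
  rewrite /M' /= M4 M0 enc0 [cell _ _ _]addn0 muln0 addn0.
  by rewrite !upd_neq ?M4 ?M3 ?addn0 //; lia.
have lowM' z : z \in [:: 1; 2; 4] -> M' z = M z.
  by rewrite M'E !inE => zz; rewrite !upd_neq // /cell; lia.
apply: saving_save_cell; [by lia|by rewrite lowM' ?enc1|].
split.
- by rewrite M'E /upd /= /cell; lia.
- by rewrite lowM' // M'E.
- by rewrite lowM'.
- by rewrite M'E; do 2![apply: saved_low; first lia]; exact: saved_store.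
- by move=> z zb; rewrite M'E !upd_neq ?Mz // /cell; lia.
Qed.

Lemma save_low_halts bits : size bits = 6 ->
  (forall i, i < 6 -> enc (2 + i) = nth false bits i) ->
  halts (save_low bits) enc (m * 4 + 30) (saving 8).
Proof.
move=> sz encE; have bg := heap_base_ge.
pose I k M := [/\ M 0 = n /\ M 1 = m, M 2 = 1 /\ M 3 = k, M 4 + k * n = base, saved 0 M &
  forall z, 8 <= z -> M z = enc z].
pose sizes := [:: IStore 4 0; IAdd 0 4 3; IConst 3 8] ++ save_cell 1.
apply: (halts_weaken (t := 6 + (m * 4 + 1 + 23)) _ (fun _ => id)); first by lia.
apply: (halts_seq (Q1 := I m) (halts_block _ _)) => // [|M IM].
  split.
  - by rewrite /= /upd /= enc0 enc1.
  - by rewrite /= /upd /= enc1 addnK.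
  - by rewrite /= /upd /= enc0 enc1 /heap_base; lia.
  - by rewrite /=; do ![apply: saved_low; first lia]; exact: saved0.
  - by do 8?case.
apply: (halts_seq (halts_while (I := I) (t := 2) _ _ IM)).
- by move=> k M1 [_ []].
- move=> k {IM}M [[M0 M1] [M2 M3] M4 sM Mz]; apply: (@halts_block [:: _; _]) => //.
  split.
  - by rewrite /= /upd /= M0.
  - by rewrite /= /upd /= M2 M3 subn1.
  - by rewrite /= /upd /= M0; lia.
  - by rewrite /=; do ![apply: saved_low; first lia].
  - by move=> z z8; rewrite /= !upd_neq ?Mz //; lia.
move=> {IM}M [M01 [M2 M3] M4 sM Mz].
have [<- basic_save] : size (sizes ++ flatten [seq save_bit b | b <- bits]) = 23 /\
    all basic (sizes ++ flatten [seq save_bit b | b <- bits]).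
  by case: bits sz {encE} => [|? [|? [|? [|? [|? [|? []]]]]]].
apply: halts_block; rewrite ?catA // foldl_cat -[X in saving X]/(2 + 6) -{1}sz.
apply: saving_save_bits; first by rewrite sz.
by apply: saving_sizes; split=> //; split=> //; rewrite -M4 mul0n addn0.
Qed.

Definition copied (k : nat) (M : memory) : Prop :=
  [/\ saving (base - k) M, M 5 = k, M 6 = base - k & k <= base - 8].

Lemma save_next_halts k M : copied k.+1 M -> halts (Block save_next) M 5 (copied k).
Proof.
move=> [sM M5 M6 kb]; have [_ [M2 M3] _ _ Mz] := sM; have bg := heap_base_ge.
set M' := upd (upd M 5 k) 7 (enc (base - k.+1)).
have sM' : saving (base - k.+1) M' by do 2![apply: saving_upd => //].
have M'E z : z \in [:: 2; 5; 6] -> M' z = if z == 5 then k else M z.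
  by rewrite /M' /upd !inE; case: (z =P 7) => // ->.
have M'0 : M' 0 + 8 = cell base 0 (base - k.+1) by case: sM'.
have loaded : exec_block M [:: ISub 5 5 2; ILoad 7 6] = M'.
  by rewrite /= M5 M2 subn1 (@upd_neq _ _ _ 6) // M6 upd_neq ?Mz //; lia.
apply: (@halts_block save_next) => //.
rewrite -[exec_block _ _]/(exec_block (exec_block
  (exec_block M [:: ISub 5 5 2; ILoad 7 6]) (save_cell 7)) [:: IAdd 6 6 2]) loaded.
have M'3 : M' 3 = 8 by [].
have low z : z \in [:: 2; 5; 6] ->
    exec_block M' (save_cell 7) z = if z == 5 then k else M z.
  move=> zz; rewrite -M'E //= M'3 updE M'0 !upd_neq // /cell.
    by move: zz; rewrite !inE; lia.
  by move: zz; rewrite !inE; lia.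
have sM2 : saving (base - k) (exec_block M' (save_cell 7)).
  have -> : base - k = (base - k.+1).+1 by lia.
  by apply: saving_save_cell; rewrite ?updE //; lia.
move: (exec_block M' _) low sM2 => M2' low sM2; split.
- exact: saving_upd.
- by rewrite /= upd_neq // low.
- by rewrite /= updE !low //= M6 M2; lia.
- exact: ltnW.
Qed.

Lemma boot_halts :
  halts boot enc (m * 4 + 42 + (base * 7 + 6))
    (fun M => [/\ M 0 = 1, M 1 = base &
       forall a y, a < 8 -> M (cell base a y) = if a == 0 then enc y else 0]).
Proof.
have bg := heap_base_ge.
apply: halts_seq (_ : halts _ _ _ (saving 8)) _.
  rewrite -[42]/(30 + 2 * 6) addnA; apply: halts_with_bits.
  apply: save_low_halts => // i i6.
  rewrite (nth_map 0) ?size_iota // nth_iota //.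
  by have := @enc_bit (2 + i) isT; case: (enc _) => [|[|]].
move=> M sM; have [_ [M2 M3] M4 _ Mz] := sM.
apply: (halts_weaken (t := 2 + ((base - 8) * 7 + 1 + 3)) _ (fun _ => id)); first by lia.
apply: (halts_seq (Q1 := copied (base - 8)) (halts_block _ _)) => // [|M' cM'].
  rewrite /= updE upd_neq // M4; split=> //.
  - by rewrite subKn; [do 2![apply: saving_upd => //]|lia].
  - by rewrite /= upd_neq // updE subKn //; lia.
apply: (halts_seq (halts_while (I := copied) (t := 5) _ _ cM')).
- by move=> k M1 [].
- exact: save_next_halts.
move=> M1 [s1 _ _ _]; rewrite subn0 in s1; have [_ _ M14 sM1 _] := s1.
apply: (@halts_block [:: _; _; _]) => //; split=> //.
  by rewrite /= upd_neq // updE upd_neq // updE M14 addn0.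
move=> a y a8; rewrite /=; have := sM1 y a a8; have := enc_end (x := y).
rewrite !upd_neq; [|rewrite /cell; lia..] => encE ->.
case: eqP => //= _; case: ltnP => // yb.
by rewrite encE // ; move: yb; rewrite /heap_base; lia.
Qed.
End Boot.

(** * Writing the output *)

Section WriteBack.
Variables v a : nat.

(* Register 2 counts the entries still to be copied, register 4 points to the next one
   and register 6 to its destination. *)
Definition write_next : seq instr :=
  [:: ISub 2 2 0; ILoad 7 4; IStore 6 7; IAdd 4 4 3; IAdd 6 6 0].

Definition write_high : code :=
  Seq (Block [:: IConst 3 8; ISub 2 (reg v) 3; IConst 4 (8 * 8 + a); IAdd 4 4 1;
                 IConst 6 8])
      (While 2 (Block write_next)).

(* Register 1 holds the base address and is therefore the last one to receive
   the address of its own value, computed from that of register 2. *)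
Definition low_addresses : seq instr :=
  flatten [seq [:: IConst j (8 * j + a); IAdd j j 1] | j <- [:: 0; 2; 3; 4; 5; 6; 7]] ++
  [:: IConst 1 8; ISub 1 2 1].

Definition self_loads (k : nat) : seq instr := [seq ILoad j j | j <- iota 0 k].

Definition write_back : code :=
  Seq write_high (Seq (Block low_addresses) (Block (self_loads 8))).

Lemma exec_self_loads M k : (forall j, j < k -> k <= M j) -> forall x,
  exec_block M (self_loads k) x = if x < k then M (M x) else M x.
Proof.
move=> high.
suff gen l : l <= k -> forall x,
    exec_block M (self_loads l) x = if x < l then M (M x) else M x by exact: gen.
elim: l => [//|l IH] lk x.
rewrite /self_loads -addn1 iotaD map_cat foldl_cat /=.
move: {IH}(IH (ltnW lk)); move: (foldl _ _ _) => M' M'E.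
rewrite /upd addn1 ltnS; case: (ltngtP x l) => [xl|xl|->].
- by rewrite M'E xl.
- by rewrite M'E ltnNge (ltnW xl).
- by rewrite !M'E ltnn ltnNge (leq_trans (ltnW lk) (high _ lk)).
Qed.

Variable base : nat.
Hypotheses (base_ge : 24 <= base) (a8 : a < 8).
Variable M : memory.
Variable N : nat.
Hypotheses (N_ge : 8 <= N) (N_le : N <= base).

Definition written (k : nat) (M' : memory) : Prop :=
  [/\ M' 0 = 1 /\ M' 1 = base, M' 2 = k /\ M' 3 = 8,
      [/\ M' 4 = cell base a (N - k), M' 6 = N - k & k + 8 <= N],
      (forall y, base <= y -> M' y = M y) &
      forall j, 8 <= j < N - k -> M' j = M (cell base a j)].

Lemma write_next_halts k M1 :
  written k.+1 M1 -> halts (Block write_next) M1 5 (written k).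
Proof.
move=> [[one base1] [count stride] [source target kN] high low].
apply: (@halts_block write_next) => //.
have [x8 xb] : 8 <= N - k.+1 /\ N - k.+1 < base by lia.
have next : N - k = (N - k.+1).+1 by lia.
set x := N - k.+1 in source target low x8 xb next.
have -> : exec_block M1 write_next = upd (upd (upd (upd (upd M1 2 k)
    7 (M (cell base a x))) x (M (cell base a x))) 4 (cell base a x.+1)) 6 x.+1.
  rewrite /= count one subn1 (@upd_neq _ _ _ 4) // source.
  rewrite (@upd_neq _ _ _ (cell _ _ _)); last by rewrite /cell; lia.
  rewrite high; last by rewrite /cell -addnA leq_addr.
  rewrite updE; set M2 := upd _ 7 _.
  have -> : M2 6 = x by rewrite /M2 !upd_neq.
  have M2E z : z \in [:: 0; 3; 4; 6] -> upd M2 x (M (cell base a x)) z = M1 z.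
    by rewrite !inE /M2 => zz; rewrite !upd_neq //; lia.
  rewrite !M2E // source stride [upd _ 4 _ 6]upd_neq // [upd _ 4 _ 0]upd_neq //.
  rewrite !M2E // target one addn1.
  by rewrite (_ : cell base a x + 8 = cell base a x.+1) // /cell; lia.
split.
- by rewrite !upd_neq ?one ?base1 //; lia.
- split; first by rewrite 4?upd_neq ?updE //; lia.
  by rewrite !upd_neq ?stride //; lia.
- by rewrite upd_neq // !updE next; split=> //; lia.
- by move=> y yb; rewrite !upd_neq ?high //; lia.
move=> j jx; rewrite upd_neq ?(@upd_neq _ 4); [|lia..].
have [->|ne] := eqVneq j x; first by rewrite updE.
by rewrite !upd_neq ?low //; lia.
Qed.

Lemma low_addresses_correct M1 : M1 1 = base ->
  (forall j, j < 8 -> exec_block M1 low_addresses j = cell base a j) /\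
  (forall y, 8 <= y -> exec_block M1 low_addresses y = M1 y).
Proof.
move=> base1; split; last by do 8?case=> //.
by case=> [|[|[|[|[|[|[|[|//]]]]]]]] _; rewrite /= /upd /= base1 /cell; lia.
Qed.

Lemma write_high_halts : M 0 = 1 -> M 1 = base -> N = M (reg v) - 8 + 8 ->
  halts write_high M (5 + ((N - 8) * 7 + 1)) (written 0).
Proof.
move=> one base1 N_eq.
apply: (halts_seq (Q1 := written (N - 8)) (halts_block _ _)) => // [|M1 M1w].
  rewrite /written subKn // /reg /= !(@upd_neq _ _ _ (v + 4)); [|lia..].
  rewrite !updE -/(reg v); split.
  - by rewrite !upd_neq.
  - by rewrite 3?upd_neq // updE N_eq addnK 4?upd_neq // updE.
  - by rewrite (@upd_neq _ 6) // updE !upd_neq // base1 /cell; split=> //; lia.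
  - by move=> y yb; rewrite !upd_neq //; lia.
  - by move=> j /andP[j8]; rewrite ltnNge j8.
apply: halts_while M1w; first by move=> k M2 [_ []].
exact: write_next_halts.
Qed.

Lemma write_low_correct M1 : written 0 M1 -> forall j, j < N ->
  exec_block (exec_block M1 low_addresses) (self_loads 8) j = M (cell base a j).
Proof.
move=> [[_ base1] _ _ high low] j jN.
have [addr other] := low_addresses_correct base1.
rewrite exec_self_loads => [|i i8]; last by rewrite addr // /cell; lia.
case: ltnP => j8; last by rewrite other // low // j8 subn0.
by rewrite (addr j) // other ?high // /cell; lia.
Qed.

End WriteBack.

Lemma write_back_halts v a base s M : reg nvars <= base -> a < 8 -> v < nvars ->
  represents base s M -> vars s v <= base ->
  halts (write_back v a) M (vars s v * 7 + 40)
    (fun M' => forall j, j < vars s v -> M' j = arrays s a j).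
Proof.
move=> base_ge a8 vn [one base1 var_s array_s] vb; have bg : 24 <= base := base_ge.
pose N := vars s v - 8 + 8.
have [N8 Nb vN] : [/\ 8 <= N, N <= base & vars s v <= N] by rewrite /N; split; lia.
apply: (halts_weaken (t := 5 + ((N - 8) * 7 + 1) + (16 + 8)) (Q := fun M' =>
  forall j, j < N -> M' j = M (cell base a j))).
- by rewrite /N; lia.
- by move=> M' M'E j jv; rewrite M'E ?array_s // (leq_trans jv).
apply: halts_seq (write_high_halts bg a8 N8 Nb one base1 _) _; first by rewrite var_s.
move=> M1 M1w.
apply: (halts_seq (Q1 := eq (exec_block M1 (low_addresses a))) (halts_block _ _)) => //.
move=> _ <-.
by apply: halts_block => // j; exact: write_low_correct.
Qed.

Arguments eval : simpl never.

(** * Tests, searches and tables *)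

Definition v_n := 0.
Definition v_m := 1.
Definition v_one := 2.
Definition v_zero := 3.
Definition v_flag := 4.
Definition v_spare := 5.

Definition holds (c : cmd) (s : state) : bool := vars (eval c s) v_flag != 0.

Definition Not (c : cmd) : cmd := c ;; Minus v_flag v_one v_flag.

Definition And (c1 c2 : cmd) : cmd := c1 ;; Cond v_flag c2 Skip.

Definition test_neq (u w : nat) : cmd :=
  Minus v_flag u w ;; Minus v_spare w u ;; Plus v_flag v_flag v_spare.

Definition search (u b x : nat) (c : cmd) : cmd :=
  Plus x b v_zero ;;
  For u b (c ;; Cond v_flag (Plus x u v_zero) Skip) ;;
  Minus v_flag b x.

Definition tabulate (u b a : nat) (c : cmd) (v : nat) : cmd := For u b (c ;; Put a u v).

Lemma holds_then c1 c2 s : holds (c1 ;; c2) s = holds c2 (eval c1 s).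
Proof. by []. Qed.

Lemma holds_and c1 c2 s : holds (And c1 c2) s = holds c1 s && holds c2 (eval c1 s).
Proof. by rewrite /holds /And /= [eval (_ ;; _) s]/eval -/eval; case: ifP. Qed.

Lemma holds_not c s : ~~ writes_var v_one c -> vars s v_one = 1 ->
  holds (Not c) s = ~~ holds c s.
Proof.
move=> c_one one_s; rewrite /holds; set x := vars (eval c s) v_flag.
have -> : vars (eval (Not c) s) v_flag = vars (eval c s) v_one - x by [].
by rewrite vars_eval // one_s; case: x.
Qed.

Lemma holds_neq u w s : v_flag \notin [:: u; w] ->
  holds (test_neq u w) s = (vars s u != vars s w).
Proof.
rewrite !inE negb_or ![v_flag == _]eq_sym => /andP[/negPf uf /negPf wf].
have -> : holds (test_neq u w) s =
    ((vars s u - vars s w) + (vars (eval (Minus v_flag u w) s) w -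
                              vars (eval (Minus v_flag u w) s) u) != 0) by [].
by rewrite !vars_set_var uf wf; lia.
Qed.

Definition found (N : nat) (D : pred nat) (x : nat) : Prop :=
  (x < N /\ D x) \/ (x = N /\ forall k, k < N -> ~~ D k).

Lemma found_exists N D x : found N D x -> (x < N) = [exists k : 'I_N, D k].
Proof.
case=> [[xN Dx]|[-> none]].
  by rewrite xN; apply/esym/existsP; exists (Ordinal xN).
by rewrite ltnn; apply/esym/existsP=> -[k]; apply/negP/none.
Qed.

Section Search.
Variables (u b x : nat) (c : cmd).

Local Notation cmd_search := (search u b x c).

Definition searchable : bool :=
  [&& ~~ writes_var b cmd_search, ~~ writes_var v_zero cmd_search,
      ~~ writes_var x c, ~~ writes_var u c & x \notin [:: u; v_flag]].

Hypothesis is_searchable : searchable.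
Variables (s : state) (D : pred nat).
Hypothesis zero_s : vars s v_zero = 0.
Hypothesis c_decides : forall k s', k < vars s b -> agree_off cmd_search s s' ->
  vars s' u = k -> holds c s' = D k.

Lemma search_found : found (vars s b) D (vars (eval cmd_search s) x).
Proof.
have := is_searchable; rewrite /searchable !inE negb_or.
case/and5P=> b_sc zero_sc x_c u_c /andP[/negPf xu /negPf xf].
set loop := For u b (c ;; Cond v_flag (Plus x u v_zero) Skip).
pose I k s' := (vars s' x < vars s b /\ D (vars s' x)) \/
  (vars s' x = vars s b /\ forall j, k <= j < vars s b -> ~~ D j).
set s0 := eval (Plus x b v_zero) s.
have agree0 : agree_off cmd_search s s0.
  by apply: agree_off_sub (agree_off_eval _ _) => //= v ->.
have s0b : vars s0 b = vars s b by apply: (proj1 agree0).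
have s0x : vars s0 x = vars s b by rewrite vars_set_var eqxx zero_s addn0.
have -> : vars (eval cmd_search s) x = vars (eval loop s0) x.
  by rewrite -[eval cmd_search s]/(set_var (eval loop s0) v_flag _) vars_set_var xf.
suff : I 0 (eval loop s0) by case=> [[? ?]|[-> none]]; [left|right].
apply: for_ind => [|k s' kN agree Ik].
  right; rewrite vars_set_var xu s0b s0x; split=> // j.
  by case/andP=> /leq_ltn_trans lt /lt; rewrite ltnn.
set s1 := set_var s' u k in agree *; rewrite s0b in kN.
have {}agree : agree_off cmd_search s s1.
  apply: agree_off_trans agree0 _; apply: agree_off_sub agree => y /= ->.
    by rewrite orbT.
  by [].
have s1u : vars s1 u = k by rewrite vars_set_var eqxx.
have -> : eval (c ;; Cond v_flag (Plus x u v_zero) Skip) s1 =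
    if D k then set_var (eval c s1) x k else eval c s1.
  rewrite -(c_decides kN agree s1u).
  rewrite -[LHS]/(if holds c s1 then eval (Plus x u v_zero) (eval c s1) else _).
  case: ifP => // _; rewrite /eval -/eval.
  congr set_var; rewrite !vars_eval ?s1u ?(proj1 agree) ?zero_s ?addn0 //.
  by move: zero_sc; rewrite /= !negb_or => /and3P[_ /and3P[]].
case: (boolP (D k)) => Dk; first by left; rewrite vars_set_var eqxx.
have e : vars (eval c s1) x = vars s' x by rewrite vars_eval // vars_set_var xu.
case: Ik => [[xN Dx]|[xN none]]; [left|right]; rewrite e //; split=> // j.
case/andP; rewrite leq_eqVlt => /orP[/eqP<-//|kj] jN.
by apply: none; rewrite kj.
Qed.

Lemma holds_search_lt : holds cmd_search s = (vars (eval cmd_search s) x < vars s b).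
Proof.
set x' := vars _ x; have := is_searchable; rewrite /searchable !inE negb_or.
case/and5P=> b_sc _ _ _ /andP[_ /negPf xf].
set loop := Plus x b v_zero ;; For u b (c ;; Cond v_flag (Plus x u v_zero) Skip).
have -> : x' = vars (eval loop s) x.
  by rewrite /x' -[eval cmd_search s]/(set_var (eval loop s) v_flag _) vars_set_var xf.
have <- : vars (eval loop s) b = vars s b.
  by rewrite vars_eval //; move: b_sc; rewrite /= !negb_or => /and3P[-> -> _].
by rewrite -subn_gt0 lt0n.
Qed.

Lemma holds_search : holds cmd_search s = [exists k : 'I_(vars s b), D k].
Proof. by rewrite holds_search_lt (found_exists search_found). Qed.

Lemma search_correct :
  if holds cmd_search s then
    vars (eval cmd_search s) x < vars s b /\ D (vars (eval cmd_search s) x)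
  else forall k, k < vars s b -> ~~ D k.
Proof.
by rewrite holds_search_lt; case: search_found => [[-> //]|[-> none]]; rewrite ltnn.
Qed.

End Search.

Lemma tabulate_correct u b a c v s (D : nat -> nat -> Prop) :
  ~~ writes_var u c -> ~~ writes_array a c ->
  (forall k s', k < vars s b -> agree_off (tabulate u b a c v) s s' -> vars s' u = k ->
     D k (vars (eval c s') v)) ->
  forall k, if k < vars s b then D k (arrays (eval (tabulate u b a c v) s) a k)
            else arrays (eval (tabulate u b a c v) s) a k = arrays s a k.
Proof.
move=> u_c a_c c_computes.
pose I k s' := forall j, if k <= j < vars s b then D j (arrays s' a j)
  else arrays s' a j = arrays s a j.
suff : I 0 (eval (tabulate u b a c v) s) by [].
apply: for_ind => [j|k s' kN agree Ik j]; first by case: ltnP; rewrite ?andbF.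
set s1 := set_var s' u k.
have -> : eval (c ;; Put a u v) s1 = set_array (eval c s1) a k (vars (eval c s1) v).
  rewrite -[eval _ _]/(set_array _ _ (vars (eval c s1) u) _) (vars_eval s1 u_c).
  by rewrite vars_set_var eqxx.
rewrite arrays_set_array eqxx arrays_eval //=.
have := Ik j; rewrite [k <= j]leq_eqVlt; have [->|_] := eqVneq j k; last by [].
by rewrite kN /= => _; apply: c_computes => //; rewrite vars_set_var eqxx.
Qed.

(** * The algorithm *)

Definition v_bit := 6.
Definition v_color := 7.
Definition v_i := 8.
Definition v_feature := 9.
Definition v_j := 10.
Definition v_k := 11.
Definition v_exemplar := 12.
Definition v_red := 13.
Definition v_blue := 14.
Definition v_neighbor := 15.
Definition v_offset := 16.
Definition v_round := 17.

Definition a_input := 0.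
Definition a_output := 1.
Definition a_red := 2.
Definition a_blue := 3.
Definition a_live := 4.
Definition a_rows := 5.

Definition load_sizes : cmd :=
  Const v_zero 0 ;; Get v_n a_input v_zero ;; Const v_one 1 ;; Get v_m a_input v_one.

(* The machine has no multiplication, so the position [2 + n + j * n] of every row
   of the incidence matrix in the input is tabulated by additions. *)
Definition first_row : cmd :=
  Const v_offset 2 ;; Plus v_offset v_offset v_n ;; Const v_j 0.
Definition next_row : cmd :=
  Put a_rows v_j v_offset ;; Plus v_j v_j v_one ;; Plus v_offset v_offset v_n.
Definition fill_rows : cmd := first_row ;; For v_k v_m next_row.

Definition test_mem (u : nat) : cmd :=
  Get v_spare a_rows u ;; Plus v_spare v_spare v_i ;; Get v_flag a_input v_spare.

Definition test_color (b : bool) : cmd :=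
  Const v_spare 2 ;; Plus v_spare v_spare v_i ;; Get v_bit a_input v_spare ;;
  Const v_color (~~ b) ;; test_neq v_bit v_color.

Definition test_meets (b : bool) (u w : nat) : cmd :=
  search v_i v_n v_feature (And (test_mem u) (And (test_mem w) (test_color b))).

Definition find_partner (b : bool) : cmd :=
  search v_k v_m v_exemplar (And (test_neq v_j v_k) (test_meets b v_j v_k)).

Definition test_live : cmd :=
  And (test_meets true v_j v_j) (And (test_meets false v_j v_j)
    (Not (search v_k v_m v_exemplar
            (And (test_meets true v_j v_k) (Not (test_meets false v_k v_k)))))).

Definition fill_tables : cmd :=
  tabulate v_j v_m a_red (find_partner false) v_exemplar ;;
  tabulate v_j v_m a_blue (find_partner true) v_exemplar ;;
  tabulate v_j v_m a_live test_live v_flag ;;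
  tabulate v_j v_m a_output (Not (test_meets false v_j v_j)) v_flag.

Definition test_matchable (u : nat) : cmd :=
  And (Get v_flag a_live u) (And (Get v_red a_red u ;; Get v_flag a_live v_red)
    (Get v_blue a_blue u ;; test_neq v_red v_blue)).

Definition test_leaf : cmd :=
  And (test_matchable v_j) (Get v_neighbor a_blue v_j ;; Not (test_matchable v_neighbor)).

Definition pick : cmd :=
  search v_j v_m v_exemplar test_leaf ;;
  Cond v_flag Skip (search v_j v_m v_exemplar (test_matchable v_j)).

Definition match_pick : cmd :=
  Get v_red a_red v_exemplar ;;
  Put a_output v_exemplar v_one ;; Put a_output v_red v_one ;;
  Get v_blue a_blue v_exemplar ;; Get v_neighbor a_blue v_red ;;
  Put a_live v_exemplar v_zero ;; Put a_live v_red v_zero ;;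
  Put a_live v_blue v_zero ;; Put a_live v_neighbor v_zero.

Definition greedy_round : cmd := pick ;; Cond v_flag match_pick Skip.

Definition main : cmd := fill_rows ;; fill_tables ;; For v_round v_m greedy_round.

(** * Correctness of the tables *)

Section Instance.
Variables (n m : nat) (T : {set 'I_n}) (S : 'I_m -> {set 'I_n}).
Local Notation enc := (encode T S).

Definition exemplar (j : nat) : {set 'I_n} := if insub j is Some j' then S j' else set0.

Lemma exemplarE (j : 'I_m) : exemplar j = S j.
Proof. by rewrite /exemplar valK. Qed.

Lemma exemplar_ge j : m <= j -> exemplar j = set0.
Proof. by move=> mj; rewrite /exemplar insubF // ltnNge mj. Qed.

Lemma encode_bit x : 1 < x -> enc x <= 1.
Proof.
case: x => [|[|x]] // _; rewrite /encode /=.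
case: ifP => _; first by case: insub => // i; case: (_ \in _).
case: ifP => // _; case: insub => // j; case: insub => // i.
by case: (_ \in _).
Qed.

Lemma encode_end x : 2 + n + m * n <= x -> enc x = 0.
Proof.
by move=> xge; rewrite /encode !ifF //; lia.
Qed.

Lemma encode_target (i : 'I_n) : enc (2 + i) = (i \in T).
Proof. by rewrite /encode ltn_add2l ltn_ord addKn valK. Qed.

Lemma encode_exemplar j (i : 'I_n) :
  j < m -> enc (2 + n + j * n + i) = (i \in exemplar j).
Proof.
move=> jm; have n0 : 0 < n := leq_ltn_trans (leq0n i) (ltn_ord i).
have lt_jn : j.+1 * n <= m * n by rewrite leq_mul2r jm orbT.
have i_n := ltn_ord i; rewrite mulSn in lt_jn.
have x_ge : (2 + n + j * n + i < 2 + n) = false by lia.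
have x_lt : 2 + n + j * n + i < 2 + n + m * n by lia.
rewrite /encode x_ge x_lt /=; have -> : 2 + n + j * n + i - (2 + n) = j * n + i by lia.
rewrite divnMDl // divn_small // addn0 modnMDl modn_small // valK /exemplar.
by case: insub => // *; rewrite inE.
Qed.

Definition loaded (s : state) : Prop :=
  [/\ vars s v_n = n /\ vars s v_m = m, vars s v_one = 1 /\ vars s v_zero = 0,
      arrays s a_input = enc &
      forall j, j < m -> arrays s a_rows j = 2 + n + j * n].

Definition preserves_input (c : cmd) : bool :=
  all (fun v => ~~ writes_var v c) [:: v_n; v_m; v_one; v_zero] &&
  all (fun a => ~~ writes_array a c) [:: a_input; a_rows].

Lemma loaded_agree c s s' :
  preserves_input c -> agree_off c s s' -> loaded s -> loaded s'.
Proof.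
case/andP=> /and5P[? ? ? ? _] /and3P[? ? _] [ev ea].
case=> [[n_s m_s] [one_s zero_s] input_s rows_s].
by split; rewrite ?ea ?ev.
Qed.

Lemma loaded_eval c s : preserves_input c -> loaded s -> loaded (eval c s).
Proof. by move=> pc; apply: loaded_agree pc (agree_off_eval c s). Qed.

Lemma holds_mem u s (i : 'I_n) :
  u != v_spare -> loaded s -> vars s u < m -> vars s v_i = i ->
  holds (test_mem u) s = (i \in exemplar (vars s u)).
Proof.
move=> us [_ _ input_s rows_s] um ui.
rewrite -[holds _ s]/(arrays s a_input (arrays s a_rows (vars s u) + vars s v_i) != 0).
by rewrite input_s rows_s // ui encode_exemplar //; case: (i \in _).
Qed.

Lemma holds_color b s (i : 'I_n) : loaded s -> vars s v_i = i ->
  holds (test_color b) s = ((i \in T) == b).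
Proof.
move=> [_ _ input_s _] ui; rewrite /test_color 4!holds_then holds_neq //.
have -> : vars (eval (Const v_color (~~ b)) _) v_color = ~~ b by [].
set x := vars _ v_bit; have {x}-> : x = arrays s a_input (2 + vars s v_i) by [].
by rewrite input_s ui encode_target; case: (i \in T); case: b.
Qed.

Lemma holds_meets b u w s : u \in [:: v_j; v_k] -> w \in [:: v_j; v_k] ->
  loaded s -> vars s u < m -> vars s w < m ->
  holds (test_meets b u w) s = meets T b (exemplar (vars s u)) (exemplar (vars s w)).
Proof.
move=> u_jk w_jk ls um wm; set X := exemplar _; set Y := exemplar _.
have fixed v : v \in [:: v_j; v_k] -> ~~ writes_var v (test_meets b u w).
  by rewrite !inE => /orP[]/eqP->.
have not_spare v : v \in [:: v_j; v_k] -> v != v_spare by rewrite !inE => /orP[]/eqP->.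
have [[n_s _] [_ zero_s] _ _] := ls.
rewrite (holds_search _ (D := fun k => [exists i in shade T b (X :&: Y), val i == k])) //.
  rewrite n_s; apply/existsP/set0Pn => [[k /exists_inP[i ib _]]|[i ib]].
    by exists i.
  by exists i; apply/exists_inP; exists i.
move=> k s'; rewrite n_s => kn agree s'i; pose i := Ordinal kn.
have -> : [exists i in shade T b (X :&: Y), val i == k] = (i \in shade T b (X :&: Y)).
  apply/exists_inP/idP => [[i' i'b /eqP e]|ib]; last by exists i.
  by rewrite (_ : i = i') //; apply: val_inj.
have ls' : loaded s' by apply: loaded_agree agree ls.
have [ev _] := agree; have s'u := ev _ (fixed _ u_jk); have s'w := ev _ (fixed _ w_jk).
rewrite !holds_and (@holds_mem _ _ i) ?not_spare ?s'u // -/X.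
set s2 := eval (test_mem u) s'.
have ls2 : loaded s2 by apply: loaded_eval.
have s2w : vars s2 w = vars s w.
  by rewrite vars_eval //; move: w_jk; rewrite !inE => /orP[]/eqP->.
rewrite (@holds_mem _ _ i) ?not_spare ?s2w // -/Y.
by rewrite (@holds_color _ _ i) ?in_shade ?inE ?andbA //.
Qed.

Lemma find_partner_found b s : loaded s -> vars s v_j < m ->
  found m (fun k => (vars s v_j != k) && meets T b (exemplar (vars s v_j)) (exemplar k))
    (vars (eval (find_partner b) s) v_exemplar).
Proof.
move=> ls jm; have [[_ m_s] [_ zero_s] _ _] := ls; rewrite -{1}m_s.
apply: (search_found _) => // k s'; rewrite m_s => km agree s'k.
have ls' : loaded s' by apply: loaded_agree agree ls.
have [/(_ v_j isT) s'j _] := agree.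
rewrite holds_and holds_neq // s'j s'k; congr (_ && _).
set s2 := eval _ s'; have ls2 : loaded s2 by apply: loaded_eval.
have s2j : vars s2 v_j = vars s v_j by rewrite vars_eval.
have s2k : vars s2 v_k = k by rewrite vars_eval.
by rewrite holds_meets ?s2j ?s2k.
Qed.

Definition live_exemplar (j : nat) : bool :=
  [&& meets T true (exemplar j) (exemplar j), meets T false (exemplar j) (exemplar j) &
     ~~ [exists k : 'I_m, meets T true (exemplar j) (exemplar k) &&
                           ~~ meets T false (exemplar k) (exemplar k)]].

Lemma holds_live s : loaded s -> vars s v_j < m ->
  holds test_live s = live_exemplar (vars s v_j).
Proof.
move=> ls jm; rewrite /test_live 2!holds_and holds_meets //.
set s1 := eval _ s; have ls1 : loaded s1 by apply: loaded_eval.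
have s1j : vars s1 v_j = vars s v_j by rewrite vars_eval.
rewrite holds_meets ?s1j //; set s2 := eval _ s1.
have ls2 : loaded s2 by apply: loaded_eval.
have s2j : vars s2 v_j = vars s v_j by rewrite vars_eval.
have [[_ m_s2] [one_s2 zero_s2] _ _] := ls2; rewrite holds_not // /live_exemplar.
set D := fun k => meets T true (exemplar (vars s v_j)) (exemplar k) &&
  ~~ meets T false (exemplar k) (exemplar k).
rewrite (holds_search _ (D := D)) // ?m_s2 //.
move=> k s' km agree s'k; have ls' : loaded s' by apply: loaded_agree agree ls2.
have [/(_ v_j isT) s'j _] := agree.
rewrite holds_and holds_meets ?s'j ?s2j ?s'k //; set s3 := eval _ s'.
have ls3 : loaded s3 by apply: loaded_eval.
have [_ [one_s3 _] _ _] := ls3; have s3k : vars s3 v_k = k by rewrite vars_eval.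
by rewrite holds_not // holds_meets ?s3k.
Qed.

Lemma fill_rows_loaded s : vars s v_n = n -> vars s v_m = m -> vars s v_one = 1 ->
  vars s v_zero = 0 -> arrays s a_input = enc -> loaded (eval fill_rows s).
Proof.
move=> n_s m_s one_s zero_s input_s.
rewrite /loaded !vars_eval // [arrays _ a_input]arrays_eval //; split=> //.
pose I k s' := [/\ vars s' v_j = m - k, vars s' v_offset = 2 + n + (m - k) * n &
  forall j, j < m - k -> arrays s' a_rows j = 2 + n + j * n].
suff [_ _] : I 0 (eval (For v_k v_m next_row) (eval first_row s)) by rewrite subn0.
have initm : vars (eval first_row s) v_m = m by rewrite vars_eval.
apply: for_ind; first by rewrite initm /I subnn mul0n addn0 -n_s.
rewrite initm => k s' km [ev _] [s'j s'offset rows].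
have one_s' : vars s' v_one = 1.
  by rewrite -[LHS]/(vars (set_var s' v_k k) v_one) ev // vars_eval.
have n_s' : vars s' v_n = n.
  by rewrite -[LHS]/(vars (set_var s' v_k k) v_n) ev // vars_eval.
have mk : m - k = (m - k.+1).+1 by lia.
split.
- by rewrite -[LHS]/(vars s' v_j + vars s' v_one) s'j mk one_s' addn1.
- by rewrite -[LHS]/(vars s' v_offset + vars s' v_n) s'offset mk n_s'; lia.
move=> j.
rewrite -[arrays _ _]/(arrays
  (set_array s' a_rows (vars s' v_j) (vars s' v_offset)) a_rows).
rewrite arrays_set_array s'j s'offset mk ltnS leq_eqVlt eqxx /=.
by case: eqP => [->//|_ /= /rows].
Qed.

Definition found_partner (b : bool) (j : nat) (x : nat) : Prop :=
  found m (fun k => (j != k) && meets T b (exemplar j) (exemplar k)) x.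

Definition tables_filled (A : nat -> nat -> nat) : Prop :=
  [/\ forall j, if j < m then found_partner false j (A a_red j) else A a_red j = 0,
      forall j, if j < m then found_partner true j (A a_blue j) else A a_blue j = 0,
      forall j, (A a_live j != 0) = (j < m) && live_exemplar j &
      forall j, j < m ->
        (A a_output j != 0) = ~~ meets T false (exemplar j) (exemplar j)].

Lemma tabulate_loaded c v a s (D : nat -> nat -> Prop) :
  preserves_input (tabulate v_j v_m a c v) ->
  ~~ writes_var v_j c -> ~~ writes_array a c ->
  loaded s ->
  (forall s', loaded s' -> vars s' v_j < m -> D (vars s' v_j) (vars (eval c s') v)) ->
  forall j, if j < m then D j (arrays (eval (tabulate v_j v_m a c v) s) a j)
            else arrays (eval (tabulate v_j v_m a c v) s) a j = arrays s a j.
Proof.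
move=> pc j_c a_c ls c_computes j; have [[_ m_s] _ _ _] := ls; rewrite -{1}m_s; move: j.
apply: tabulate_correct => // k s'; rewrite m_s => km agree s'k; rewrite -s'k.
by apply: c_computes; [exact: loaded_agree agree ls|rewrite s'k].
Qed.

Lemma fill_tables_correct s : loaded s -> (forall a j, a \in [:: a_red; a_blue; a_live] ->
  arrays s a j = 0) -> tables_filled (arrays (eval fill_tables s)).
Proof.
move=> ls zero; rewrite /fill_tables.
set c_red := tabulate _ _ a_red _ _; set c_blue := tabulate _ _ a_blue _ _.
set c_live := tabulate _ _ a_live _ _; set c_out := tabulate _ _ _ _ _.
rewrite -[eval _ s]/(eval c_out (eval c_live (eval c_blue (eval c_red s)))).
set s1 := eval c_red s; set s2 := eval c_blue s1; set s3 := eval c_live s2.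
have ls1 : loaded s1 by apply: loaded_eval.
have ls2 : loaded s2 by apply: loaded_eval.
have ls3 : loaded s3 by apply: loaded_eval.
split=> j.
- rewrite arrays_eval // /s3 arrays_eval // /s2 arrays_eval //.
  rewrite -[X in _ = X](zero a_red j) //.
  apply: (tabulate_loaded (D := found_partner false)) => // s'; exact: find_partner_found.
- rewrite arrays_eval // /s3 arrays_eval // -[X in _ = X](zero a_blue j) //.
  rewrite -(@arrays_eval c_red s) //.
  apply: (tabulate_loaded (D := found_partner true)) => // s'; exact: find_partner_found.
- rewrite arrays_eval //.
  have := @tabulate_loaded test_live v_flag a_live s2
    (fun j x => (x != 0) = live_exemplar j) isT isT isT ls2 holds_live j.
  by case: ltnP => // _ ->; rewrite /s2 arrays_eval // /s1 arrays_eval // zero.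
move=> jm; have := @tabulate_loaded (Not (test_meets false v_j v_j)) v_flag a_output s3
  (fun j x => (x != 0) = ~~ meets T false (exemplar j) (exemplar j)) isT isT isT ls3 _ j.
rewrite jm; apply=> s' ls' s'm; have [_ [one_s' _] _ _] := ls'.
by rewrite -[LHS]/(holds _ s') holds_not // holds_meets.
Qed.

(** * Correctness of a greedy round *)

Definition matchable_at (A : nat -> nat -> nat) (j : nat) : bool :=
  [&& A a_live j != 0, A a_live (A a_red j) != 0 & A a_red j != A a_blue j].

Lemma eq_matchable_at A A' : {in [:: a_live; a_red; a_blue], A =1 A'} ->
  matchable_at A =1 matchable_at A'.
Proof. by move=> eA j; rewrite /matchable_at !eA. Qed.

Lemma holds_matchable u s : u != v_flag -> u != v_red ->
  holds (test_matchable u) s = matchable_at (arrays s) (vars s u).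
Proof.
move=> /negPf uf /negPf ur; rewrite /test_matchable 2!holds_and; congr (_ && _).
set s1 := eval _ s; have s1u : vars s1 u = vars s u by rewrite vars_set_var uf.
rewrite holds_then -[X in X && _]/(arrays s a_live (arrays s a_red (vars s1 u)) != 0) s1u.
congr (_ && _); set s2 := eval _ s1; rewrite holds_then holds_neq //.
have s2u : vars s2 u = vars s u.
  rewrite -s1u /s2 -[eval _ s1]/(set_var (set_var s1 v_red _) v_flag _).
  by rewrite !vars_set_var uf ur.
rewrite -[vars _ v_red]/(arrays s a_red (vars s1 u)) s1u.
by rewrite -[vars _ v_blue]/(arrays s a_blue (vars s2 u)) s2u.
Qed.

Definition leaf_at (A : nat -> nat -> nat) (j : nat) : bool :=
  matchable_at A j && ~~ matchable_at A (A a_blue j).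

Lemma eq_leaf_at A A' : {in [:: a_live; a_red; a_blue], A =1 A'} ->
  leaf_at A =1 leaf_at A'.
Proof. by move=> eA j; rewrite /leaf_at !(eq_matchable_at eA) eA. Qed.

Lemma holds_leaf s :
  vars s v_one = 1 -> holds test_leaf s = leaf_at (arrays s) (vars s v_j).
Proof.
move=> one_s; rewrite /test_leaf holds_and holds_matchable //; congr (_ && _).
set s2 := eval _ s; set s3 := eval (Get v_neighbor a_blue v_j) s2.
have s2a a : arrays s2 a = arrays s a by rewrite /s2 arrays_eval.
have s3neighbor : vars s3 v_neighbor = arrays s a_blue (vars s v_j).
  by rewrite -[LHS]/(arrays s2 a_blue (vars s2 v_j)) s2a vars_eval.
rewrite holds_then -/s3 holds_not ?vars_eval // holds_matchable // s3neighbor.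
by rewrite (@eq_matchable_at (arrays s3) (arrays s)) // => a _; rewrite -s2a.
Qed.

Lemma pick_correct s : vars s v_m = m -> vars s v_one = 1 -> vars s v_zero = 0 ->
  let A := arrays s in let c := vars (eval pick s) v_exemplar in
  if holds pick s then
    [/\ c < m, matchable_at A c & ~~ matchable_at A (A a_blue c) \/
          forall j, j < m -> matchable_at A j -> matchable_at A (A a_blue j)]
  else forall j, j < m -> ~~ matchable_at A j.
Proof.
move=> m_s one_s zero_s A; set leaf := search v_j v_m v_exemplar test_leaf.
set any := search v_j v_m v_exemplar (test_matchable v_j).
have leafD k s' : k < vars s v_m -> agree_off leaf s s' -> vars s' v_j = k ->
    holds test_leaf s' = leaf_at A k.
  move=> _ [ev ea] <-; rewrite holds_leaf; last by rewrite ev.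
  by apply: eq_leaf_at => a; rewrite !inE => /or3P[]/eqP->; rewrite ea.
have := @search_correct v_j v_m v_exemplar test_leaf isT s _ zero_s leafD.
rewrite -/leaf m_s; set s' := eval leaf s.
have [m_s' zero_s'] : vars s' v_m = m /\ vars s' v_zero = 0 by rewrite !vars_eval.
have anyD k s2 : k < vars s' v_m -> agree_off any s' s2 -> vars s2 v_j = k ->
    holds (test_matchable v_j) s2 = matchable_at A k.
  move=> _ [ev ea] <-; rewrite holds_matchable //; apply: eq_matchable_at => a.
  by rewrite !inE => /or3P[]/eqP->; rewrite ea ?arrays_eval.
have := @search_correct v_j v_m v_exemplar (test_matchable v_j) isT s' _ zero_s' anyD.
rewrite -/any m_s'.
have pickE : eval pick s = if holds leaf s then s' else eval any s' by [].
have -> : holds pick s = holds leaf s || holds any s'.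
  by rewrite {1}/holds pickE; case: ifP.
rewrite pickE; case: (holds leaf s) => /= [_ [cm /andP[mc lc]]|].
  by split=> //; left.
case: (holds any s') => // -[cm mc] no_leaf; split=> //; right=> j jm mj.
by have := no_leaf j jm; rewrite /leaf_at mj negbK.
Qed.

Definition matched (A : nat -> nat -> nat) (c : nat) (A' : nat -> nat -> nat) : Prop :=
  [/\ forall x, A' a_live x =
        if x \in [:: c; A a_red c; A a_blue c; A a_blue (A a_red c)] then 0
        else A a_live x,
      forall x, A' a_output x = if x \in [:: c; A a_red c] then 1 else A a_output x,
      A' a_red = A a_red & A' a_blue = A a_blue].

Lemma match_pick_correct s : vars s v_one = 1 -> vars s v_zero = 0 ->
  matched (arrays s) (vars s v_exemplar) (arrays (eval match_pick s)).
Proof.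
move=> one_s zero_s; set A := arrays s; set c := vars s _.
split=> [x|x||]; last by rewrite arrays_eval.
- have -> : arrays (eval match_pick s) a_live =
      upd (upd (upd (upd (A a_live) c (vars s v_zero)) (A a_red c) (vars s v_zero))
        (A a_blue c) (vars s v_zero)) (A a_blue (A a_red c)) (vars s v_zero) by [].
  by rewrite zero_s !inE /upd; do ?[case: (x == _) => //].
- have -> : arrays (eval match_pick s) a_output = upd (upd (A a_output) c (vars s v_one))
    (A a_red c) (vars s v_one) by [].
  by rewrite one_s !inE /upd; do ?[case: (x == _) => //].
by rewrite arrays_eval.
Qed.

(** * Optimality of the computed subcollection *)

Hypotheses (occurrence2 : k_occurrence 2 S) (weight2 : w_weight 2 S).

Lemma mem_exemplar i j : i \in exemplar j -> exists2 j' : 'I_m, j = j' & i \in S j'.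
Proof. by rewrite /exemplar; case: insubP => [j' _ <- ij|]; [exists j'|rewrite inE]. Qed.

Lemma exemplar_occurrence i j k l : i \in exemplar j -> i \in exemplar k ->
  i \in exemplar l -> k != j -> l != j -> k = l.
Proof.
move=> /mem_exemplar[j' -> ij] /mem_exemplar[k' -> ik] /mem_exemplar[l' -> il].
rewrite !(inj_eq val_inj) => kj lj; congr val.
by apply: (card_le2_eq (occurrence2 i) (j := j')); rewrite ?inE.
Qed.

(* One more exemplar, empty, plays the role of a missing partner. *)
Definition family (j : 'I_m.+1) : {set 'I_n} := exemplar j.

Lemma family_weight j : #|family j| <= 2.
Proof.
by rewrite /family /exemplar; case: insub => [j'|]; [exact: weight2|rewrite cards0].
Qed.

Lemma family_ge (j : 'I_m.+1) b X : m <= j -> meets T b (family j) X = false.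
Proof.
move=> mj; apply: (introF (meetsP _ _ _ _)) => -[i [+ _ _]].
by rewrite /family exemplar_ge // inE.
Qed.

Lemma live_lt (j : 'I_m.+1) : j \in live T family -> j < m.
Proof.
by rewrite ltnNge inE => /and3P[blue _ _]; apply: contraL blue => /family_ge->.
Qed.

Lemma mem_live_family (j : 'I_m.+1) : (j \in live T family) = (j < m) && live_exemplar j.
Proof.
apply/idP/andP=> [jl|[jm]].
  split; first exact: live_lt.
  move: jl; rewrite inE => /and3P[blue red no_pure]; apply/and3P; split=> //.
  apply/existsPn=> k; rewrite negb_and negbK -implybE; apply/implyP=> jk.
  apply: contraLR jk => kp.
  by apply: (forall_inP no_pure (widen_ord (leqnSn m) k)); rewrite inE.
case/and3P=> blue red /existsPn no_pure; rewrite inE blue red /=; apply/forall_inP=> k.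
rewrite inE => kp; have [km|mk] := ltnP k m; last by rewrite meetsC family_ge.
by have := no_pure (Ordinal km); rewrite kp andbT.
Qed.

Lemma partner_map_found b (P : nat -> nat) (f : 'I_m.+1 -> 'I_m.+1) :
  (forall j : 'I_m.+1, f j = P j :> nat) ->
  (forall j, j < m -> found_partner b j (P j)) -> partner_map T family b f.
Proof.
move=> fP fnd j jl; have jm := live_lt jl; rewrite -(inj_eq val_inj) /= fP.
case: (fnd _ jm) => [[Pm /andP[jP jPb]]|[Pm none]].
  split=> [|k kl kj]; first by rewrite eq_sym.
  apply/idP/eqP=> [jkb|<-]; last by rewrite /family fP.
  apply/val_inj; rewrite /= fP.
  have [[x [xj xP xb]] [y [yj yk yb]]] := (meetsP _ _ _ _ jPb, meetsP _ _ _ _ jkb).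
  have e : y = x.
    apply/set1P; rewrite -(live_shade family_weight jl (b := b) (i := x)) in_shade.
      by rewrite yb andbT.
    by rewrite xb andbT.
  by apply: (exemplar_occurrence xj xP); rewrite -?e // eq_sym.
split=> [|k kl kj]; first by rewrite Pm gtn_eqF.
have km := live_lt kl; rewrite -(inj_eq val_inj) /= fP Pm (gtn_eqF km).
by apply: contraNF (none _ km) => jkb; rewrite jkb andbT -(inj_eq val_inj) eq_sym in kj *.
Qed.

Section Greedy.
Variable A0 : nat -> nat -> nat.
Hypothesis filled : tables_filled A0.

Definition red_partner (j : 'I_m.+1) : 'I_m.+1 := inord (A0 a_red j).
Definition blue_partner (j : 'I_m.+1) : 'I_m.+1 := inord (A0 a_blue j).
Definition live_set (A : nat -> nat -> nat) : {set 'I_m.+1} :=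
  [set j : 'I_m.+1 | A a_live j != 0].

Local Notation p := red_partner.
Local Notation q := blue_partner.
Local Notation start := (live T family).

Lemma found_partner_le b j P :
  (if j < m then found_partner b j (P j) else P j = 0) -> P j <= m.
Proof. by case: ifP => _; [case=> [[/ltnW]|[->]]|move=> ->]. Qed.

Lemma red_partnerE j : p j = A0 a_red j :> nat.
Proof. by case: filled => /(_ j)/found_partner_le red _ _ _; rewrite inordK. Qed.

Lemma blue_partnerE j : q j = A0 a_blue j :> nat.
Proof. by case: filled => _ /(_ j)/found_partner_le blue _ _; rewrite inordK. Qed.

Lemma red_partner_map : partner_map T family false p.
Proof.
apply: (partner_map_found (P := A0 a_red)) => [j|j jm]; first exact: red_partnerE.
by case: filled => /(_ j); rewrite jm.
Qed.

Lemma blue_partner_map : partner_map T family true q.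
Proof.
apply: (partner_map_found (P := A0 a_blue)) => [j|j jm]; first exact: blue_partnerE.
by case: filled => _ /(_ j); rewrite jm.
Qed.

Lemma live_set_filled : live_set A0 = start.
Proof.
by case: filled => _ _ live0 _; apply/setP=> j; rewrite inE live0 mem_live_family.
Qed.

Lemma mem_pure (j : 'I_m.+1) : j < m -> (j \in pure T family) = (A0 a_output j != 0).
Proof. by case: filled => _ _ _ out0 jm; rewrite inE out0. Qed.

Definition same_partners (A : nat -> nat -> nat) : Prop :=
  A a_red = A0 a_red /\ A a_blue = A0 a_blue.

Lemma matchable_atE A (j : 'I_m.+1) : same_partners A ->
  matchable_at A j = matchable p q (live_set A) j.
Proof.
move=> [eA_red eA_blue]; rewrite /matchable !inE -(inj_eq val_inj) /=.
by rewrite red_partnerE blue_partnerE -eA_red -eA_blue.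
Qed.

(* With [y] rounds to go: a round empties a live dart unless nothing is matchable. *)
Definition greedy_arrays (y : nat) (A : nat -> nat -> nat) : Prop :=
  same_partners A /\ exists Y,
    [/\ partial_matching p q start (live_set A) Y,
        optimally_extendable p q start (live_set A) Y,
        forall j : 'I_m.+1, j < m ->
          (A a_output j != 0) = (j \in pure T family) || (j \in Y) &
        #|live_set A| <= y \/ forall j, ~~ matchable p q (live_set A) j].

Lemma eq_greedy_arrays y A A' : (forall a, A a = A' a) ->
  greedy_arrays y A -> greedy_arrays y A'.
Proof.
by move=> eA; rewrite /greedy_arrays /same_partners /live_set !eA.
Qed.

Lemma greedy_arrays0 : greedy_arrays m A0.
Proof.
split=> //; exists set0; rewrite live_set_filled; split.
- exact: partial_matching0.
- exact: optimally_extendable0.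
- by move=> j jm; rewrite mem_pure // inE orbF.
left; suff /proper_card : start \proper [set: 'I_m.+1] by rewrite cardsT card_ord.
rewrite properE subsetT; apply/subsetPn; exists ord_max => //.
by apply/negP=> /live_lt; rewrite ltnn.
Qed.

Lemma greedy_arrays_stop y A : (forall j, j < m -> ~~ matchable_at A j) ->
  greedy_arrays y.+1 A -> greedy_arrays y A.
Proof.
move=> none [eA [Y [pmY opt out _]]]; split=> //; exists Y; split=> //; right=> j.
rewrite -matchable_atE //; have [jm|mj] := ltnP j m; first exact: none.
have [sub _ _ _] := pmY; apply/negP=> /andP[jl _].
have /(subsetP sub)/live_lt : j \in live_set A by rewrite inE.
by rewrite ltnNge mj.
Qed.

Lemma live_set_matched A c A' : same_partners A -> matched A (val c) A' ->
  live_set A' = remaining p q (live_set A) c.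
Proof.
move=> [eA_red eA_blue] [live' _ _ _]; apply/setP=> j; rewrite in_remaining !in_set live'.
have -> : (val j \in [:: val c; A a_red c; A a_blue c; A a_blue (A a_red c)]) =
    [|| j == c, j == p c, j == q c | j == q (p c)].
  by rewrite !inE eA_red eA_blue -!(inj_eq val_inj) /= !blue_partnerE !red_partnerE.
by case: (j == c); case: (j == p c); case: (j == q c); case: (j == q (p c)).
Qed.

Lemma greedy_arrays_matched y A c A' :
  greedy_arrays y.+1 A -> c < m -> matchable_at A c ->
  (~~ matchable_at A (A a_blue c) \/
     forall j, j < m -> matchable_at A j -> matchable_at A (A a_blue j)) ->
  matched A c A' -> greedy_arrays y A'.
Proof.
move=> [eA [Y [pmY opt out cnt]]] cm matchable_c alt AA'; have [eA_red eA_blue] := eA.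
have [live' out' eA'_red eA'_blue] := AA'.
split; first by split; rewrite (eA'_red, eA'_blue).
pose d : 'I_m.+1 := Ordinal (leqW cm).
have matchable_d : matchable p q (live_set A) d by rewrite -matchable_atE.
have [sub _ _ _] := pmY.
have red_inv := partner_map_involution red_partner_map.
have blue_inv := partner_map_involution blue_partner_map.
have safe_d : safe p q (live_set A) d.
  have red_invA := partial_involutionS sub red_inv.
  have blue_invA := partial_involutionS sub blue_inv.
  case: alt => [leaf|no_leaf].
    by apply: leaf_safe => //; rewrite -matchable_atE // blue_partnerE -eA_blue.
  apply: cycle_safe => // j matchable_j.
  have jl : j \in live_set A by case/and3P: matchable_j.
  rewrite -matchable_atE // blue_partnerE -eA_blue no_leaf ?matchable_atE //.
  exact/live_lt/(subsetP sub).
exists (Y :|: [set d; p d]); rewrite (live_set_matched (c := d) eA AA'); split.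
- exact: partial_matching_add.
- by apply: optimally_extendable_add safe_d opt.
- move=> j jm; rewrite out' in_setU orbA -out //.
  have -> : (val j \in [:: c; A a_red c]) = (j \in [set d; p d]).
    by rewrite !inE eA_red -!(inj_eq val_inj) /= red_partnerE.
  by case: ifP; rewrite ?orbT ?orbF.
left; case: cnt => [le_y|/(_ d)]; last by rewrite matchable_d.
rewrite -ltnS; apply: leq_trans le_y; apply: proper_card.
rewrite properE remaining_sub; apply/subsetPn; exists d; first by case/and3P: matchable_d.
by rewrite in_remaining eqxx.
Qed.

Lemma greedy_round_correct y s : loaded s ->
  greedy_arrays y.+1 (arrays s) -> greedy_arrays y (arrays (eval greedy_round s)).
Proof.
move=> [[_ m_s] [one_s zero_s] _ _] inv.
have inv' : greedy_arrays y.+1 (arrays (eval pick s)).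
  by apply: eq_greedy_arrays inv => a; rewrite arrays_eval.
have := pick_correct m_s one_s zero_s; set s' := eval pick s in inv' *.
have eqA : matchable_at (arrays s) =1 matchable_at (arrays s').
  by apply: eq_matchable_at => a; rewrite arrays_eval.
have -> : eval greedy_round s = if holds pick s then eval match_pick s' else s' by [].
case: (holds pick s) => [[cm mc alt]|none]; last first.
  by apply: greedy_arrays_stop inv' => j jm; rewrite -eqA none.
apply: (greedy_arrays_matched inv' cm).
- by rewrite -eqA.
- rewrite [arrays s' _]arrays_eval //.
  by case: alt => [leaf|no_leaf]; [left|right=> j jm]; rewrite -!eqA //; exact: no_leaf.
by apply: match_pick_correct; rewrite vars_eval.
Qed.

Lemma greedy_arrays_optimal A : greedy_arrays 0 A ->
  optimal T S [set j : 'I_m | A a_output j != 0].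
Proof.
move=> [_ [Y [pmY opt out cnt]]].
have none j : ~~ matchable p q (live_set A) j.
  by case: cnt => [|//]; rewrite leqn0 cards_eq0 => /eqP->; rewrite /matchable inE.
have maxY := greedy_maximum pmY opt none.
pose widen : 'I_m -> 'I_m.+1 := widen_ord (leqnSn m).
have family_widen j : family (widen j) = S j := exemplarE j.
move=> B.
have coverB : appearing S B = covered family (widen @: B).
  rewrite /appearing /covered big_imset /=; last first.
    by move=> j k _ _ /(congr1 val) /= /val_inj.
  by apply: eq_bigr => j _; rewrite family_widen.
have coverY : appearing S [set j : 'I_m | A a_output j != 0] =
    covered family (pure T family :|: Y).
  apply/setP=> i; apply/bigcupP/bigcupP=> -[j jA ij].
    exists (widen j); last by rewrite family_widen.
    by rewrite in_setU -(out (widen j) (ltn_ord j)); rewrite inE in jA.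
  have [j' jj' ij'] := mem_exemplar ij; exists j' => //.
  by rewrite inE -jj' out -?in_setU // jj'.
have := maximum_matching_margin family_weight red_partner_map blue_partner_map
  (widen @: B) maxY.
rewrite /margin coverB coverY /=; lia.
Qed.

End Greedy.

Lemma main_correct s : vars s v_n = n -> vars s v_m = m -> vars s v_one = 1 ->
  vars s v_zero = 0 -> arrays s a_input = enc ->
  (forall a j, 0 < a < 8 -> arrays s a j = 0) ->
  optimal T S [set j : 'I_m | arrays (eval main s) a_output j != 0].
Proof.
move=> n_s m_s one_s zero_s input_s zero.
rewrite -[eval main s]/(eval (For v_round v_m greedy_round)
  (eval fill_tables (eval fill_rows s))).
have lr := fill_rows_loaded n_s m_s one_s zero_s input_s.
set sr := eval fill_rows s in lr *.
have filled : tables_filled (arrays (eval fill_tables sr)).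
  apply: fill_tables_correct => // a j; rewrite !inE => partner_or_live.
  by case/or3P: partner_or_live => /eqP->; rewrite /sr arrays_eval // zero.
have lt : loaded (eval fill_tables sr) by apply: loaded_eval.
set st := eval fill_tables sr in filled lt *.
apply: (greedy_arrays_optimal filled).
apply: (for_ind (I := fun y s' => greedy_arrays (arrays st) y (arrays s'))).
  by have [[_ ->] _ _ _] := lt; exact: greedy_arrays0.
move=> y s' _ agree inv; apply: greedy_round_correct => //.
exact: loaded_agree agree lt.
Qed.

End Instance.

(** * The solver *)

Definition solver : code :=
  Seq boot (Seq (compile load_sizes) (Seq (compile main) (write_back v_m a_output))).

Definition solver_time (n m : nat) : nat :=
  (m * 4 + 42 + (heap_base n m * 7 + 6)) +
  (cost 0 load_sizes + (cost (n + m) main + (m * 7 + 40))).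

Lemma solver_halts (n m : nat) (T : {set 'I_n}) (S : 'I_m -> {set 'I_n}) :
  k_occurrence 2 S -> w_weight 2 S ->
  halts solver (encode T S) (solver_time n m) (fun M => optimal T S (decode m M)).
Proof.
move=> occurrence2 weight2; set enc := encode T S; set base := heap_base n m.
have base_ge : reg nvars <= base := heap_base_ge n m.
have bits := @encode_bit n m T S; have tail := @encode_end n m T S.
apply: halts_seq (@boot_halts n m enc erefl erefl bits tail) _.
move=> M1 [M1_0 M1_1 heap].
pose s1 := State (fun v => M1 (reg v)) (fun a => if a == a_input then enc else fun=> 0).
have R1 : represents base s1 M1 by split=> //= a i a8; rewrite heap //; case: eqP.
have load := compile_correct base_ge (bs := [::]) (B := 0) (c := load_sizes) isT isT.
apply: halts_seq (load _ _ R1 _) _ => //.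
move=> M2; set s2 := eval load_sizes s1 => R2.
have [n_s2 m_s2 one_s2 zero_s2] :
    [/\ vars s2 v_n = n, vars s2 v_m = m, vars s2 v_one = 1 & vars s2 v_zero = 0] by [].
have s2B : bounded [:: v_n; v_m] (n + m) s2.
  by move=> b; rewrite !inE => /orP[]/eqP->; rewrite (n_s2, m_s2) (leq_addr, leq_addl).
apply: halts_seq (compile_correct base_ge (c := main) _ _ R2 s2B) _ => //.
move=> M3 R3; have m_s3 : vars (eval main s2) v_m = m by rewrite vars_eval.
have m_base : vars (eval main s2) v_m <= base by rewrite m_s3 /base /heap_base; lia.
have := write_back_halts (v := v_m) (a := a_output) base_ge isT isT R3 m_base.
rewrite m_s3; apply: halts_weaken => // M4 out.
have -> : decode m M4 = [set j : 'I_m | arrays (eval main s2) a_output j != 0].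
  by apply/setP=> j; rewrite !inE out.
by apply: main_correct => // a j /andP[a0 _]; rewrite arrays_eval //= gtn_eqF.
Qed.

Lemma solver_time_polynomial n m :
  solver_time n m <= (cost 1 main + 400) * (n + m + 1) ^ (depth main).+2.
Proof.
set N := n + m + 1; have N0 : 0 < N by rewrite /N addn1.
have widen k l : k <= l -> N ^ k <= N ^ l by move=> kl; rewrite leq_pexp2l.
have main_le : cost (n + m) main <= cost 1 main * N ^ (depth main).+2.
  apply: leq_trans (cost_polynomial main (n + m)) _.
  by rewrite -[(n + m).+1]addn1 -/N leq_mul2l widen ?orbT // -addn2 leq_addr.
have base_le : heap_base n m <= 24 * N ^ 2 by rewrite /heap_base /N; nia.
have m_le : m <= N ^ 2 by rewrite /N; nia.
have N2_gt0 : 0 < N ^ 2 by rewrite expn_gt0 N0.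
have N2_le : N ^ 2 <= N ^ (depth main).+2 by exact: widen.
rewrite mulnDl /solver_time -[cost 0 load_sizes]/16.
move: (N ^ 2) base_le m_le N2_gt0 N2_le => sq base_le m_le sq_gt0.
move: (N ^ _) main_le => pow; move: (cost 1 main * pow) => lead main_le sq_le.
lia.
Qed.

Theorem theorem9 :
  exists (prog : seq instr) (c k : nat),
    forall (n m : nat) (T : {set 'I_n}) (S : 'I_m -> {set 'I_n}),
      valid_instance T S ->
      k_occurrence 2 S ->
      w_weight 2 S ->
      exists M : memory,
        run (c * (n + m + 1) ^ k) prog 0 (encode T S) = Some M /\
        optimal T S (decode m M).
Proof.
exists (assemble 0 solver), (cost 1 main + 400), (depth main).+2.
move=> n m T S _ occurrence2 weight2.
have solved := solver_halts T occurrence2 weight2.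
have := halts_weaken (solver_time_polynomial n m) (fun _ => id) solved.
by move=> /halts_run[M runM optM]; exists M.
Qed.
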